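(* Let $F$, $(F_n)_{n\ge 1}$, $\Psi$, $\mathbf{R}$, $(\mathbf{R}_n)_{n\ge1}$, $\mathbf{r}$, $(\mathbf{r}_n)_{n\ge1}$, $\mathbf{B}$, $\mathbf{A}_n$, $\Theta_n$, $(\mathbf{D}_n)_{n\ge1}$ and the sequence $(\mathbf{h}_n)_{n\ge1}$ generated by the MM subspace algorithm be as described in the context, and suppose that Assumptions 1 and 2 (stated in the context) hold. Let $\epsilon\in\,]0,+\infty[$ be such that $\epsilon \mathbf{I}_N \prec \mathbf{R}$. Then there exists $n_\epsilon\in\mathbb{N}^*$ such that, for every $n\ge n_\epsilon$, $\nabla^2 F_n(\mathbf{h}_n)\succeq \mathbf{R}-\epsilon \mathbf{I}_N$ and $$F_n(\mathbf{h}_{n+1})-\inf F_n \le \theta_n\big(F_n(\mathbf{h}_n)-\inf F_n\big),$$ where $\theta_n = 1-(1+\epsilon)^{-1}\widetilde{\theta}_n$, $$\widetilde{\theta}_n=\frac{\big(\nabla F_n(\mathbf{h}_n)\big)^\top \mathbf{C}_n(\mathbf{h}_n)\nabla F_n(\mathbf{h}_n)}{\big(\nabla F_n(\mathbf{h}_n)\big)^\top\big(\nabla^2F_n(\mathbf{h}_n)\big)^{-1}\nabla F_n(\mathbf{h}_n)},$$ $\mathbf{C}_n(\mathbf{h}_n)=\mathbf{D}_n\big(\mathbf{D}_n^\top\mathbf{A}_n(\mathbf{h}_n)\mathbf{D}_n\big)^\dagger\mathbf{D}_n^\top$, and $(\cdot)^\dagger$ denotes the pseudo-inverse operation. Furthermore,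 lower and upper bounds on $\theta_n$, i.e. $\underline{\theta}_n\le\theta_n\le\overline{\theta}_n$, are given by $$\underline{\theta}_n = 1-(1+\epsilon)^{-1}\underline{\kappa}_n^{-1}>0,$$ $$\overline{\theta}_n = 1-(1+\epsilon)^{-1}\overline{\kappa}_n^{-1}\left(1-\Big(\frac{\overline{\sigma}_n-\underline{\sigma}_n}{\overline{\sigma}_n+\underline{\sigma}_n}\Big)^2\right)<1,$$ where $\underline{\kappa}_n\ge 1$ (resp. $\overline{\kappa}_n$) is the minimum (resp. maximum) eigenvalue of $\big(\mathbf{A}_n(\mathbf{h}_n)\big)^{1/2}\big(\nabla^2F_n(\mathbf{h}_n)\big)^{-1}\big(\mathbf{A}_n(\mathbf{h}_n)\big)^{1/2}$, and $\underline{\sigma}_n$ (resp. $\overline{\sigma}_n$) is the minimum (resp. maximum) eigenvalue of $\nabla^2F_n(\mathbf{h}_n)$.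
   Context: Notation: $\mathbb{N}^*=\{1,2,\dots\}$; $\preceq$ and $\prec$ are the weak and strict Loewner orders on symmetric matrices; $\mathbf{I}_N$ is the $N\times N$ identity; $\operatorname{ran}$ is the range of a matrix; $\nabla^2$ denotes the Hessian; $\|\cdot\|$ applied to vectors is the Euclidean norm and applied to matrices is a matrix norm (e.g. the spectral norm). Cost functions. $F\colon\mathbb{R}^N\to\mathbb{R}$, $F(\mathbf{h})=\frac12\mathbf{h}^\top\mathbf{R}\mathbf{h}-\mathbf{r}^\top\mathbf{h}+\Psi(\mathbf{h})$, where $\mathbf{r}\in\mathbb{R}^N$, $\mathbf{R}\in\mathbb{R}^{N\times N}$ is symmetric positive definite, and $\Psi\colon\mathbb{R}^N\to\mathbb{R}$ is lower-bounded, twice-continuously differentiable and convex. For every $n\in\mathbb{N}^*$, $F_n\colon\mathbb{R}^N\to\mathbb{R}$, $F_n(\mathbf{h})=\frac12\mathbf{h}^\top\mathbf{R}_n\mathbf{h}-\mathbf{r}_n^\top\mathbf{h}+\Psi(\mathbf{h})$, where the vector $\mathbf{r}_n\in\mathbb{R}^N$ and the symmetric nonnegative definite matrix $\mathbf{R}_n\in\mathbb{R}^{N\times N}$ are approximations of $\mathbf{r}$ and $\mathbf{R}$. Majorant. $\mathbf{B}$ assigns to each $\mathbf{h}\in\mathbb{R}^N$ a symmetric nonnegative definite matrix $\mathbf{B}(\mathbf{h})\in\mathbb{R}^{N\times N}$, $\mathbf{A}_n(\mathbf{h})=\mathbf{R}_n+\mathbf{B}(\mathbf{h})$, and $$\Theta_n(\mathbf{h},\mathbf{h}_n)=F_n(\mathbf{h}_n)+\nabla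 F_n(\mathbf{h}_n)^\top(\mathbf{h}-\mathbf{h}_n)+\tfrac12(\mathbf{h}-\mathbf{h}_n)^\top\mathbf{A}_n(\mathbf{h}_n)(\mathbf{h}-\mathbf{h}_n).$$ It is assumed that, for every $n\in\mathbb{N}^*$ and every $\mathbf{h}\in\mathbb{R}^N$, $F_n(\mathbf{h})-F_n(\mathbf{h}_n)\le\Theta_n(\mathbf{h},\mathbf{h}_n)-\Theta_n(\mathbf{h}_n,\mathbf{h}_n)$. MM subspace algorithm. $\mathbf{h}_1\in\mathbb{R}^N$ is an initial value and, for every $n\in\mathbb{N}^*$, $\mathbf{h}_{n+1}\in\operatorname{Argmin}_{\mathbf{h}\in\operatorname{ran}\mathbf{D}_n}\Theta_n(\mathbf{h},\mathbf{h}_n)$, where $\mathbf{D}_n\in\mathbb{R}^{N\times M_n}$, $M_n\ge1$, is constructed in such a way that $-\nabla F_n(\mathbf{h}_n)\in\operatorname{ran}\mathbf{D}_n$. Assumption 1. (i) $(\|\mathbf{r}_n-\mathbf{r}_{n+1}\|)_{n\ge1}$ and $(\|\mathbf{R}_n-\mathbf{R}_{n+1}\|)_{n\ge1}$ are summable sequences; (ii) $(\mathbf{r}_n)_{n\ge1}$ and $(\mathbf{R}_n)_{n\ge1}$ converge to $\mathbf{r}$ and $\mathbf{R}$, respectively. Assumption 2. (i) For every $n\in\mathbb{N}^*$, $\{\nabla F_n(\mathbf{h}_n),\mathbf{h}_n\}\subset\operatorname{ran}\mathbf{D}_n$; (ii) there exists a positive definite matrix $\mathbf{V}$ such that, for every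 $n\in\mathbb{N}^*$, $\nabla^2\Psi(\mathbf{h}_n)\preceq\mathbf{B}(\mathbf{h}_n)\preceq\mathbf{V}$; (iii) at least one of the following statements holds: (a) $\mathbf{r}_n=\mathbf{r}$ and $\mathbf{R}_n=\mathbf{R}$ for every $n\in\mathbb{N}^*$; (b) $\mathbf{h}\mapsto\mathbf{B}(\mathbf{h})\mathbf{h}-\nabla\Psi(\mathbf{h})$ is a bounded function. *)

(* Defs.v *)
From HB Require Import structures.
From mathcomp Require Import all_boot all_order all_algebra.
From mathcomp Require Import all_classical all_reals all_analysis.

Set Implicit Arguments.
Unset Strict Implicit.
Unset Printing Implicit Defensive.
Import Order.TTheory GRing.Theory Num.Theory.
Import numFieldNormedType.Exports.

Local Open Scope classical_set_scope.
Local Open Scope ring_scope.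

Section Matrices.
Context {R : realType}.

Definition dot n (u v : 'cV[R]_n) : R := (u^T *m v) 0 0.

(* The library norm on matrices is the max norm; these are the Euclidean norm
   of vectors and the spectral norm of matrices. *)
Definition enorm n (x : 'cV[R]_n) : R := Num.sqrt (dot x x).

Definition spectral_norm m n (A : 'M[R]_(m, n)) : R :=
  sup [set enorm (A *m x) | x in [set x : 'cV[R]_n | enorm x <= 1]].

Definition psdmx n (A : 'M[R]_n) : Prop :=
  A^T = A /\ forall x : 'cV[R]_n, 0 <= dot x (A *m x).

Definition pdmx n (A : 'M[R]_n) : Prop :=
  A^T = A /\ forall x : 'cV[R]_n, x != 0 -> 0 < dot x (A *m x).

Definition loewner_le n (A B : 'M[R]_n) : Prop := psdmx (B - A).

Definition loewner_lt n (A B : 'M[R]_n) : Prop := pdmx (B - A).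

(* Range for the action on column vectors (%MS only compares row spaces). *)
Definition ranmx m n (A : 'M[R]_(m, n)) : set 'cV[R]_m :=
  range (fun u : 'cV[R]_n => A *m u).

(* The library's pinvmx is not the Moore-Penrose inverse, which is the only
   matrix satisfying the four Penrose equations. *)
Definition is_mp_inverse m n (A : 'M[R]_(m, n)) (X : 'M[R]_(n, m)) : Prop :=
  [/\ A *m X *m A = A, X *m A *m X = X,
      (A *m X)^T = A *m X & (X *m A)^T = X *m A].

Definition mp_inverse m n (A : 'M[R]_(m, n)) : 'M[R]_(n, m) :=
  get (is_mp_inverse A).

(* For A nonnegative definite there is a unique such matrix. *)
Definition sqrtmx n (A : 'M[R]_n) : 'M[R]_n :=
  get [set X | psdmx X /\ X *m X = A].

(* Meaningful when A has a real eigenvalue, e.g. A symmetric and n > 0. *)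
Definition min_eigenvalue n (A : 'M[R]_n) : R :=
  get [set a | eigenvalue A a /\ forall b, eigenvalue A b -> a <= b].

Definition max_eigenvalue n (A : 'M[R]_n) : R :=
  get [set a | eigenvalue A a /\ forall b, eigenvalue A b -> b <= a].

End Matrices.

Section Calculus.
Context {R : realType} {N : nat}.
Implicit Types (f : 'cV[R]_N -> R) (x : 'cV[R]_N).

Definition partial f (i : 'I_N) x : R := 'D_(delta_mx i 0) f x.

Definition grad f x : 'cV[R]_N := \col_i partial f i x.

Definition hess f x : 'M[R]_N := \matrix_(i, j) partial (partial f i) j x.

Definition C2 f : Prop :=
  [/\ forall x, differentiable f x,
      forall x, differentiable (grad f) x
    & continuous (hess f)].

Definition argmin (S : set 'cV[R]_N) f : set 'cV[R]_N :=
  [set x | S x /\ forall y, S y -> f x <= f y].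

End Calculus.

Section MMSubspace.
Context {R : realType} {N : nat}.

Definition pls_cost (Rm : 'M[R]_N) (r : 'cV[R]_N) (Psi : 'cV[R]_N -> R)
    (h : 'cV[R]_N) : R :=
  2^-1 * dot h (Rm *m h) - dot r h + Psi h.

Definition majorant (f : 'cV[R]_N -> R) (A : 'M[R]_N) (h k : 'cV[R]_N) : R :=
  f k + dot (grad f k) (h - k) + 2^-1 * dot (h - k) (A *m (h - k)).

Definition mm_C m (A : 'M[R]_N) (D : 'M[R]_(N, m)) : 'M[R]_N :=
  D *m mp_inverse (D^T *m A *m D) *m D^T.

(* Both terms of the quotient vanish when grad f h = 0, and the value is then
   0 by the convention on division by zero. *)
Definition theta_tilde m (f : 'cV[R]_N -> R) (A : 'M[R]_N) (D : 'M[R]_(N, m))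
    (h : 'cV[R]_N) : R :=
  dot (grad f h) (mm_C A D *m grad f h) /
  dot (grad f h) (invmx (hess f h) *m grad f h).

End MMSubspace.

(* Main.v *)
Require Import Defs.
From HB Require Import structures.
From mathcomp Require Import all_boot all_order all_algebra.
From mathcomp Require Import all_classical all_reals all_analysis.
From mathcomp Require Import zify ring lra.
Set Implicit Arguments.
Unset Strict Implicit.
Unset Printing Implicit Defensive.
Import Order.TTheory GRing.Theory Num.Theory.
Import numFieldNormedType.Exports.
Local Open Scope classical_set_scope.
Local Open Scope ring_scope.

(** Write [g] and [H] for the gradient and the Hessian of [F_n] at [h_n], and [C]
for the matrix [mm_C A D]. Three facts give the rate.

First, the step is at least as good as that of the explicit minimiser
[h_n - C g] of the majorant on the subspace, so
[F_n (h_(n+1)) <= F_n (h_n) - (g . C g) / 2] ([mm_descent]).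

Second, for [n] large, [F_n (h_n) - inf F_n <= (1 + eps) / 2 * (g . H^-1 g)]
([pls_cost_lower]). For an exactly quadratic function the factor [1 + eps] is
absent; here it absorbs the variation of the Hessian on a fixed neighbourhood of
[h_n]. Outside that neighbourhood convexity shows that [F_n] is above [F_n (h_n)],
provided that [g] is small. Dividing the first estimate by the second gives the
factor [theta_n].

Third, the second estimate needs bounded iterates, for the uniform continuity of
the Hessian ([hess_unif_continuous]), and gradients that tend to [0]. Boundedness
comes from the level sets of [F] when the data are exact
([pls_cost_level_bounded]), and otherwise from comparing each step with the
competitor [0] of the subspace ([mm_step_bounded]). On a bounded set the cost of
passing from [F_n] to [F_(n+1)] is summable, while each step decreases [F_n] by a
fixed multiple of [|g|^2] ([mm_descent_grad]); hence the gradients vanish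
([gradient_cvg0]).

The bounds on [theta_n] are linear algebra ([theta_bounds]). The extreme
eigenvalues of [A^(1/2) H^-1 A^(1/2)] are the best constants comparing [H^-1] with
[A^-1]; [C <= A^-1] gives one side, and the other follows by keeping only the
direction [g] of the subspace and applying Kantorovich's inequality. The spectral
facts needed for real symmetric matrices are derived from the minimisation of the
Rayleigh quotient on the sphere and, for square roots, from deflation. *)

(** * The Euclidean inner product *)

Section Dot.
Context {R : realType}.

Lemma dotE n (u v : 'cV[R]_n) : dot u v = \sum_i u i 0 * v i 0.
Proof. by rewrite /dot mxE; apply: eq_bigr => i _; rewrite mxE. Qed.

Lemma dotC n (u v : 'cV[R]_n) : dot u v = dot v u.
Proof. by rewrite !dotE; apply: eq_bigr => i _; rewrite mulrC. Qed.

Lemma dotDr n (u v w : 'cV[R]_n) : dot u (v + w) = dot u v + dot u w.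
Proof. by rewrite /dot mulmxDr mxE. Qed.

Lemma dotDl n (u v w : 'cV[R]_n) : dot (v + w) u = dot v u + dot w u.
Proof. by rewrite dotC dotDr !(dotC u). Qed.

Lemma dotZr n (u v : 'cV[R]_n) a : dot u (a *: v) = a * dot u v.
Proof. by rewrite /dot -scalemxAr mxE. Qed.

Lemma dotZl n (u v : 'cV[R]_n) a : dot (a *: u) v = a * dot u v.
Proof. by rewrite dotC dotZr dotC. Qed.

Lemma dotNr n (u v : 'cV[R]_n) : dot u (- v) = - dot u v.
Proof. by rewrite -scaleN1r dotZr mulN1r. Qed.

Lemma dotNl n (u v : 'cV[R]_n) : dot (- u) v = - dot u v.
Proof. by rewrite dotC dotNr dotC. Qed.

Lemma dot0r n (u : 'cV[R]_n) : dot u 0 = 0.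
Proof. by rewrite -(scale0r u) dotZr mul0r. Qed.

Lemma dot0l n (u : 'cV[R]_n) : dot 0 u = 0.
Proof. by rewrite dotC dot0r. Qed.

Definition dotEs :=
  (dotDl, dotDr, dotNl, dotNr, dotZl, dotZr, dot0l, dot0r).

(** The matrix is an argument, so that rewriting distributes only the products
by that matrix, while the definitions of other vectors stay folded. *)
Definition mulmxEs n p (A : 'M[R]_(n, p)) :=
  (@mulmxDr R n p 1 A, @mulmxN R n p 1 A,
   fun a v => esym (@scalemxAr R n p 1 a A v), @mulmx0 R n p 1 A).

Lemma dot_ge0 n (u : 'cV[R]_n) : 0 <= dot u u.
Proof. by rewrite dotE sumr_ge0 // => i _; rewrite -expr2 sqr_ge0. Qed.

Lemma dot_eq0 n (u : 'cV[R]_n) : (dot u u == 0) = (u == 0).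
Proof.
apply/idP/eqP => [|->]; last by rewrite dot0r.
rewrite dotE psumr_eq0; last by move=> i _; rewrite -expr2 sqr_ge0.
move=> /allP u0; apply/matrixP => i j; rewrite ord1 mxE.
by have := u0 i (mem_index_enum _); rewrite /= -expr2 sqrf_eq0 => /eqP.
Qed.

Lemma dot_gt0 n (u : 'cV[R]_n) : (0 < dot u u) = (u != 0).
Proof. by rewrite lt_def dot_eq0 dot_ge0 andbT. Qed.

Lemma dot_mul m n (A : 'M[R]_(m, n)) x y :
  dot x (A *m y) = dot (A^T *m x) y.
Proof. by rewrite /dot trmx_mul trmxK mulmxA. Qed.

Lemma dot_symmx n (A : 'M[R]_n) x y :
  A^T = A -> dot x (A *m y) = dot y (A *m x).
Proof. by move=> As; rewrite dot_mul As dotC. Qed.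

Lemma enorm_sqr n (x : 'cV[R]_n) : enorm x ^+ 2 = dot x x.
Proof. by rewrite /enorm sqr_sqrtr ?dot_ge0. Qed.

Lemma enorm_ge0 n (x : 'cV[R]_n) : 0 <= enorm x.
Proof. exact: sqrtr_ge0. Qed.

End Dot.

(** * Definite matrices and their inverses *)

Section Psd.
Context {R : realType}.

(** The form is nonnegative at [s *: x + t *: y] for all [s] and [t]; the values
of [s] and [t] tried first minimise it, up to scaling, when a diagonal entry is
positive, and the last ones serve when both diagonal entries vanish. *)
Lemma psd_cauchy_schwarz n (A : 'M[R]_n) x y : psdmx A ->
  dot x (A *m y) ^+ 2 <= dot x (A *m x) * dot y (A *m y).
Proof.
move=> [As A0].
have E s t : 0 <= s ^+ 2 * dot x (A *m x) + 2 * s * t * dot x (A *m y)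
                  + t ^+ 2 * dot y (A *m y).
  have := A0 (s *: x + t *: y).
  rewrite !(mulmxEs A) !dotEs (dot_symmx y x As).
  by congr (0 <= _); ring.
move: E (A0 x) (A0 y); move: (dot x (A *m x)) (dot x (A *m y)) (dot y _) => a b c E a0 c0.
have [c1|c1] := ltP 0 c.
  by rewrite -(ler_pM2l c1); have := E c (- b); lra.
have [a1|a1] := ltP 0 a.
  by rewrite -(ler_pM2l a1); have := E b (- a); lra.
have {c1}c0 : c = 0 by apply: le_anti; rewrite c0 c1.
have {a1}a0 : a = 0 by apply: le_anti; rewrite a0 a1.
by have := E 1 (- b); rewrite a0 c0; lra.
Qed.

Lemma pdmx_psdmx n (A : 'M[R]_n) : pdmx A -> psdmx A.
Proof.
move=> [As A0]; split=> // x; have [->|/A0/ltW//] := eqVneq x 0.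
by rewrite dot0l.
Qed.

Lemma psdmx1 n : psdmx (1%:M : 'M[R]_n).
Proof. by split=> [|x]; rewrite ?trmx1// mul1mx dot_ge0. Qed.

Lemma dot_cauchy_schwarz n (x y : 'cV[R]_n) :
  dot x y ^+ 2 <= dot x x * dot y y.
Proof. by have := psd_cauchy_schwarz x y (psdmx1 n); rewrite !mul1mx. Qed.

Lemma dot_le_enorm n (x y : 'cV[R]_n) : `|dot x y| <= enorm x * enorm y.
Proof.
rewrite -(@ler_pXn2r _ 2) ?nnegrE ?mulr_ge0 ?enorm_ge0//.
by rewrite exprMn !enorm_sqr real_normK ?num_real// dot_cauchy_schwarz.
Qed.

Lemma psdmx_ker n (A : 'M[R]_n) x : psdmx A -> dot x (A *m x) = 0 -> A *m x = 0.
Proof.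
move=> A0 x0; have := psd_cauchy_schwarz x (A *m x) A0.
rewrite x0 mul0r (dot_symmx _ _ (proj1 A0)) => AA.
have /eqP : dot (A *m x) (A *m x) ^+ 2 = 0.
  by apply: le_anti; rewrite AA sqr_ge0.
by rewrite sqrf_eq0 dot_eq0 => /eqP.
Qed.

(** This is [A ^ 2 <= c A] for [0 <= A <= c], proved without diagonalising: by
Cauchy-Schwarz for the form of [A], applied to [x] and [A *m x], the square of
[|A x|^2] is at most [(x . A x) (c |A x|^2)]. *)
Lemma psdmx_sqr_le n (A : 'M[R]_n) c x : psdmx A ->
    (forall y, dot y (A *m y) <= c * dot y y) ->
  dot (A *m x) (A *m x) <= c * dot x (A *m x).
Proof.
move=> A0 Ac; have [As A_ge0] := A0.
have := psd_cauchy_schwarz x (A *m x) A0.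
rewrite (dot_symmx _ _ As); set d := dot (A *m x) (A *m x) => H.
have : d ^+ 2 <= dot x (A *m x) * (c * d).
  by apply: le_trans H _; apply: ler_wpM2l => //; exact: Ac.
have [d0|d0] := ltP 0 d; last first.
  suff -> : A *m x = 0 by rewrite dot0r mulr0.
  apply/eqP; rewrite -dot_eq0; apply/eqP/le_anti; rewrite d0; exact: dot_ge0.
by move=> dd; rewrite -(ler_pM2l d0); lra.
Qed.

Lemma unitmx_colP n (A : 'M[R]_n) :
  (forall x : 'cV[R]_n, A *m x = 0 -> x = 0) -> A \in unitmx.
Proof.
move=> A0; rewrite -unitmx_tr -row_free_unit; apply: inj_row_free => v vA.
apply: trmx_inj; rewrite trmx0; apply: A0.
by apply: trmx_inj; rewrite trmx_mul trmxK vA trmx0.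
Qed.

Lemma pdmx_unit n (A : 'M[R]_n) : pdmx A -> A \in unitmx.
Proof.
move=> [As A0]; apply: unitmx_colP => x Ax0; apply: contrapT => /eqP/A0.
by rewrite Ax0 dot0r ltxx.
Qed.

Lemma invmx_sym n (A : 'M[R]_n) : A^T = A -> (invmx A)^T = invmx A.
Proof. by move=> As; rewrite trmx_inv As. Qed.

Lemma pdmx_inv n (A : 'M[R]_n) : pdmx A -> pdmx (invmx A).
Proof.
move=> Apd; have [As A0] := Apd; have Au := pdmx_unit Apd.
split=> [|x x0]; first exact: invmx_sym.
rewrite dot_mul (invmx_sym As).
rewrite -[X in dot _ X](mulKVmx Au x); apply: A0.
by apply: contra x0 => /eqP x0; rewrite -(mulKVmx Au x) x0 mulmx0.
Qed.

(** Fenchel-Young inequality between the form of [H] and its conjugate form: the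
difference of the two sides is the form of [H] at [invmx H *m g - v]. It
replaces minimisation over [v] everywhere below. *)
Lemma pdmx_fenchel n (H : 'M[R]_n) g v : pdmx H ->
  2 * dot g v - dot v (H *m v) <= dot g (invmx H *m g).
Proof.
move=> Hpd; have [Hs H0] := Hpd; have Hu := pdmx_unit Hpd.
have := (pdmx_psdmx Hpd).2 (invmx H *m g - v).
rewrite !(mulmxEs H) mulKVmx// !dotEs (dot_symmx _ v Hs) mulKVmx//.
rewrite (dotC v g) (dotC _ g); lra.
Qed.

(** Apply Fenchel-Young for [P] at the maximiser [invmx Q *m g] of the conjugate
problem for [Q]. *)
Lemma invmx_antitone n (P Q : 'M[R]_n) g : pdmx P -> pdmx Q ->
    (forall x, dot x (P *m x) <= dot x (Q *m x)) ->
  dot g (invmx Q *m g) <= dot g (invmx P *m g).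
Proof.
move=> Ppd Qpd PQ; have Qu := pdmx_unit Qpd.
apply: le_trans (pdmx_fenchel g (invmx Q *m g) Ppd).
have := PQ (invmx Q *m g); rewrite mulKVmx// [X in _ <= X -> _]dotC; lra.
Qed.

End Psd.

(** * The Moore-Penrose inverse and the projected inverse of the majorant *)

Section MoorePenrose.
Context {R : realType}.

Lemma gram_unit m n (A : 'M[R]_(m, n)) :
  (forall x : 'cV[R]_n, A *m x = 0 -> x = 0) -> A^T *m A \in unitmx.
Proof.
move=> A0; apply: unitmx_colP => x AAx; apply: A0; apply/eqP.
by rewrite -dot_eq0 -{1}[A]trmxK -dot_mul mulmxA AAx dot0r.
Qed.

(** If [A = F G] is a full rank factorisation, the Gram matrices of [F] and [G]
are invertible and [G^T (G G^T)^-1 (F^T F)^-1 F^T] is the Moore-Penrose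
inverse. *)
Lemma mp_inverse_exists m n (A : 'M[R]_(m, n)) : exists X, is_mp_inverse A X.
Proof.
have [k [F [G [FG F0 G0]]]] : exists k (F : 'M[R]_(m, k)) (G : 'M[R]_(k, n)),
    [/\ F *m G = A, row_free F^T & row_free G].
  exists (\rank A), (col_base A), (row_base A).
  split; [exact: mulmx_base| |exact: row_base_free].
  by rewrite /row_free mxrank_tr; exact: col_base_full.
have uF : F^T *m F \in unitmx.
  apply: gram_unit => x Fx; apply: trmx_inj; rewrite trmx0; apply/eqP.
  rewrite -(@mulmx_free_eq0 _ _ _ _ x^T F^T)//.
  by rewrite -trmx_mul Fx trmx0.
have uG : G *m G^T \in unitmx.
  rewrite -{1}[G]trmxK; apply: gram_unit => x Gx; apply: trmx_inj.
  rewrite trmx0; apply/eqP.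
  rewrite -(@mulmx_free_eq0 _ _ _ _ x^T G)//.
  by rewrite -[G]trmxK -trmx_mul Gx trmx0.
pose X := G^T *m invmx (G *m G^T) *m invmx (F^T *m F) *m F^T.
have AX : A *m X = F *m invmx (F^T *m F) *m F^T.
  by rewrite -FG /X !mulmxA -(mulmxA F G) mulmxK.
have XA : X *m A = G^T *m invmx (G *m G^T) *m G.
  by rewrite -FG /X !mulmxA -[_ *m F^T *m F]mulmxA mulmxKV.
exists X; split.
- by rewrite AX -FG -!mulmxA (mulmxA F^T) (mulmxA (invmx _) _ G) mulVmx// mul1mx.
- by rewrite XA /X -!mulmxA (mulmxA G) (mulmxA (invmx _) (G *m G^T)) mulVmx// mul1mx.
- by rewrite AX !trmx_mul trmxK trmx_inv trmx_mul trmxK mulmxA.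
- by rewrite XA !trmx_mul trmxK trmx_inv trmx_mul trmxK mulmxA.
Qed.

Lemma mp_inverseP m n (A : 'M[R]_(m, n)) : is_mp_inverse A (mp_inverse A).
Proof. by have [X AX] := mp_inverse_exists A; exact: getI AX. Qed.

Lemma is_mp_inverse_unique m n (A : 'M[R]_(m, n)) X Y :
  is_mp_inverse A X -> is_mp_inverse A Y -> X = Y.
Proof.
move=> [AXA XAX AXs XAs] [AYA YAY AYs YAs].
have AXY : A *m X = A *m Y.
  by rewrite -AXs -{1}AYA -mulmxA trmx_mul AXs AYs mulmxA AXA.
have XYA : X *m A = Y *m A.
  rewrite -XAs -{1}AYA -(mulmxA A) mulmxA trmx_mul XAs YAs.
  by rewrite -mulmxA (mulmxA A) AXA.
by rewrite -XAX XYA -mulmxA AXY mulmxA YAY.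
Qed.

(** The Penrose equations are invariant under transposition, hence uniqueness
gives the symmetry. *)
Lemma mp_inverse_sym n (A : 'M[R]_n) : A^T = A -> (mp_inverse A)^T = mp_inverse A.
Proof.
move=> As; have [AXA XAX AXs XAs] := mp_inverseP A.
apply: is_mp_inverse_unique (mp_inverseP A); split.
- by have /(congr1 trmx) := AXA; rewrite !trmx_mul As mulmxA.
- by have /(congr1 trmx) := XAX; rewrite !trmx_mul As mulmxA.
- have -> : A *m (mp_inverse A)^T = mp_inverse A *m A; last exact: XAs.
  by rewrite -[RHS]XAs trmx_mul As.
- have -> : (mp_inverse A)^T *m A = A *m mp_inverse A; last exact: AXs.
  by rewrite -[RHS]AXs trmx_mul As.
Qed.

Lemma mm_C_sym m n (A : 'M[R]_n) (D : 'M[R]_(n, m)) :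
  A^T = A -> (mm_C A D)^T = mm_C A D.
Proof.
move=> As; rewrite /mm_C !trmx_mul trmxK mp_inverse_sym ?mulmxA//.
by rewrite !trmx_mul trmxK As mulmxA.
Qed.

(** With [C := mm_C A D], the identity [C A C = C] makes [C A] a projector; it is
the second Penrose equation between [D] and [D^T]. *)
Lemma mm_C_mul m n (A : 'M[R]_n) (D : 'M[R]_(n, m)) :
  mm_C A D *m A *m mm_C A D = mm_C A D.
Proof.
have [_ XSX _ _] := mp_inverseP (D^T *m A *m D).
by rewrite /mm_C -{3}XSX !mulmxA.
Qed.

Lemma mm_C_quad m n (A : 'M[R]_n) (D : 'M[R]_(n, m)) g : A^T = A ->
  dot (mm_C A D *m g) (A *m (mm_C A D *m g)) = dot g (mm_C A D *m g).
Proof.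
move=> As; rewrite -[X in dot (X *m _) _](mm_C_sym D As) -dot_mul.
by rewrite (mulmxA _ A) (mulmxA _ _ g) mm_C_mul.
Qed.

(** [C A] fixes the range of [D]: the defect of the first Penrose equation lies in
the kernel of [D^T A D], which is the kernel of [D] when [A] is positive
definite. *)
Lemma mm_C_range m n (A : 'M[R]_n) (D : 'M[R]_(n, m)) x : pdmx A ->
  ranmx D x -> mm_C A D *m (A *m x) = x.
Proof.
move=> Apd [w _ <-]; have [As A0] := Apd.
have [SXS _ _ _] := mp_inverseP (D^T *m A *m D).
rewrite /mm_C; set S := D^T *m A *m D in SXS *; set X := mp_inverse S in SXS *.
(* [z] is the error of [C A] at [x = D w]. *)
pose z := D *m (X *m S *m w - w).
have Sz : S *m (X *m S *m w - w) = 0.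
  by rewrite mulmxBr (mulmxA S) (mulmxA S) SXS subrr.
have z0 : z = 0.
  apply: contrapT => /eqP/A0; rewrite /z -[D]trmxK -dot_mul trmxK.
  by rewrite (mulmxA D^T A) (mulmxA _ D) -/S Sz dot0r ltxx.
apply/eqP; rewrite -subr_eq0 -[X in _ == X]z0 /z mulmxBr /S !mulmxA.
by [].
Qed.

(** [C] is dominated by [A^-1]: restricting the minimisation of the quadratic
model to the range of [D] can only worsen it. *)
Lemma mm_C_le_inv m n (A : 'M[R]_n) (D : 'M[R]_(n, m)) g : pdmx A ->
  dot g (mm_C A D *m g) <= dot g (invmx A *m g).
Proof.
move=> Apd; have := pdmx_fenchel g (mm_C A D *m g) Apd.
by rewrite mm_C_quad ?Apd.1//; lra.
Qed.

(** [C g] maximises [2 g . x - x . A x] over the range of [D], and the maximum is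
[g . C g]: the gap is the form of [A] at [C g - x]. *)
Lemma mm_C_max m n (A : 'M[R]_n) (D : 'M[R]_(n, m)) g x : pdmx A ->
  ranmx D x -> 2 * dot g x - dot x (A *m x) <= dot g (mm_C A D *m g).
Proof.
move=> Apd Dx; have [As _] := Apd.
have := (pdmx_psdmx Apd).2 (mm_C A D *m g - x).
rewrite !(mulmxEs A) !dotEs mm_C_quad// (dot_symmx _ x As).
have -> : dot x (A *m (mm_C A D *m g)) = dot g x.
  by rewrite dot_mul As dot_mul mm_C_sym// mm_C_range// dotC.
lra.
Qed.

End MoorePenrose.

(** * Extreme eigenvalues and square roots of real symmetric matrices *)

Section Spectral.
Context {R : realType}.

Lemma continuous_bigR (T : topologicalType) (I : finType) (f : I -> T -> R) :
  (forall i, continuous (f i)) -> continuous (fun x => \sum_i f i x).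
Proof. by move=> cf; apply: continuous_big => //; exact: add_continuous. Qed.

Lemma form_rV_continuous n (A : 'M[R]_n) :
  continuous (fun v : 'rV[R]_n => dot v^T (A *m v^T)).
Proof.
have -> : (fun v : 'rV[R]_n => dot v^T (A *m v^T)) =
    (fun v : 'rV[R]_n => \sum_i v 0 i * \sum_j A i j * v 0 j).
  apply/funext => v; rewrite dotE; apply: eq_bigr => i _; rewrite !mxE.
  by congr (_ * _); apply: eq_bigr => j _; rewrite !mxE.
have coordC i : continuous (fun v : 'rV[R]_n => v 0 i).
  exact: (@coord_continuous R 1 n 0 i).
apply: continuous_bigR => i v; apply: continuousM; first exact: coordC.
apply: (@continuous_bigR _ _ (fun j (v : 'rV[R]_n) => A i j * v 0 j)) => j {}v.
by apply: continuousM; [exact: (@cst_continuous _ _ (A i j))|exact: coordC].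
Qed.

Lemma dot_sphere_compact n : compact [set v : 'rV[R]_n | dot v^T v^T = 1].
Proof.
apply: bounded_closed_compact.
  exists 1; split=> // M M1 v /= v1; rewrite [`|v|]mx_normrE.
  apply/bigmax_leP; split=> [|[i j] _]; first by rewrite (le_trans ler01)// ltW.
  apply: le_trans (ltW M1); rewrite /= ord1.
  rewrite -(@ler_pXn2r _ 2) ?nnegrE// expr1n real_normK ?num_real//.
  rewrite -v1 dotE (bigD1 j)//= !mxE -expr2 lerDl sumr_ge0// => k _.
  by rewrite -expr2 sqr_ge0.
have := @form_rV_continuous n 1%:M => /continuous_closedP.
move=> /(_ [set 1]) /(_ (@closed_eq _ _)).
by congr closed; apply/seteqP; split=> v /=; rewrite mul1mx.
Qed.

(** A minimiser [x] of the Rayleigh quotient exists by compactness of the sphere.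
If [a] is the minimum then [A - a] is nonnegative and its form vanishes at [x],
so [x] is in its kernel. *)
Lemma symmx_rayleigh_min n (A : 'M[R]_n) : (0 < n)%N -> A^T = A ->
  exists a (x : 'cV[R]_n), [/\ dot x x = 1, A *m x = a *: x &
     forall y : 'cV_n, a * dot y y <= dot y (A *m y)].
Proof.
case: n A => // n A _ As; pose S := [set v : 'rV[R]_n.+1 | dot v^T v^T = 1].
have S0 : S !=set0.
  exists (delta_mx 0 0); rewrite /S/= dotE (bigD1 ord0)//= big1 => [|i i0].
    by rewrite !mxE !eqxx mulr1 addr0.
  by rewrite !mxE (negPf i0) andbF mulr0.
have [v Sv vmin] := @compact_EVT_min _ _ (fun v : 'rV[R]_n.+1 => dot v^T (A *m v^T)) _ S0
  (@dot_sphere_compact n.+1) (continuous_subspaceT (@form_rV_continuous n.+1 A)).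
pose a := dot v^T (A *m v^T); pose x := v^T.
have Sv1 : dot x x = 1 by exact: set_mem Sv.
have amin y : a * dot y y <= dot y (A *m y).
  have [->|y0] := eqVneq y 0; first by rewrite !dotEs mulr0.
  have yy : 0 < dot y y by rewrite dot_gt0.
  pose k := (Num.sqrt (dot y y))^-1.
  have k2 : k * k * dot y y = 1.
    by rewrite /k -expr2 exprVn sqr_sqrtr ?mulVf ?gt_eqF// ltW.
  have := vmin (k *: y)^T; rewrite inE trmxK -/a => /(_ _) H.
  have {}H : a <= dot (k *: y) (A *m (k *: y)).
    by apply: H; rewrite /S/= trmxK !dotEs mulrA.
  move: H; rewrite !(mulmxEs A) !dotEs mulrA.
  rewrite -(@ler_pM2r _ (dot y y))// mulrAC k2 mul1r//.
exists a, x; split=> //.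
apply/eqP; rewrite -subr_eq0 -mul_scalar_mx -mulmxBl; apply/eqP.
apply: psdmx_ker; first split.
- by rewrite linearB/= As tr_scalar_mx.
- by move=> y; rewrite mulmxBl mul_scalar_mx !dotEs subr_ge0.
- by rewrite mulmxBl mul_scalar_mx !dotEs Sv1 mulr1 subrr.
Qed.

(** [eigenvalue] speaks of row vectors; symmetry allows columns instead. *)
Lemma eigenvalue_symP n (A : 'M[R]_n) a : A^T = A ->
  eigenvalue A a <-> exists2 x : 'cV[R]_n, x != 0 & A *m x = a *: x.
Proof.
move=> As; split=> [/eigenvalueP[v vA v0]|[x x0 Ax]].
  exists v^T; first by rewrite -(inj_eq trmx_inj) trmxK trmx0.
  by apply: trmx_inj; rewrite trmx_mul trmxK As vA linearZ/= trmxK.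
apply/eigenvalueP; exists x^T; last by rewrite -(inj_eq trmx_inj) trmxK trmx0.
by rewrite -{1}As -trmx_mul Ax linearZ.
Qed.

Lemma min_eigenvalueP n (A : 'M[R]_n) : (0 < n)%N -> A^T = A ->
  (forall y, min_eigenvalue A * dot y y <= dot y (A *m y)) /\
  exists2 x : 'cV[R]_n, dot x x = 1 & A *m x = min_eigenvalue A *: x.
Proof.
move=> n0 As; have [a [x [xx Ax amin]]] := symmx_rayleigh_min n0 As.
have x0 : x != 0 by rewrite -dot_gt0 xx.
suff -> : min_eigenvalue A = a by split=> //; exists x.
have Aa : [set a | eigenvalue A a /\ forall b, eigenvalue A b -> a <= b] a.
  split=> [|b /(eigenvalue_symP _ As)[y y0 Ay]]; first by apply/eigenvalue_symP => //; exists x.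
  by have := amin y; rewrite Ay dotZr ler_pM2r// dot_gt0.
have [ea emin] := getI Aa; rewrite -/(min_eigenvalue A) in ea emin *.
by apply: le_anti; rewrite emin ?Aa.1//= Aa.2.
Qed.

Lemma max_eigenvalueP n (A : 'M[R]_n) : (0 < n)%N -> A^T = A ->
  (forall y, dot y (A *m y) <= max_eigenvalue A * dot y y) /\
  exists2 x : 'cV[R]_n, dot x x = 1 & A *m x = max_eigenvalue A *: x.
Proof.
move=> n0 As; have ANs : (- A)^T = - A by rewrite linearN/= As.
have [a [x [xx Ax amin]]] := symmx_rayleigh_min n0 ANs.
have x0 : x != 0 by rewrite -dot_gt0 xx.
have AxN : A *m x = (- a) *: x by rewrite scaleNr -Ax mulNmx opprK.
have amax y : dot y (A *m y) <= - a * dot y y.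
  by have := amin y; rewrite mulNmx dotNr; lra.
suff -> : max_eigenvalue A = - a by split=> //; exists x.
have Aa : [set a | eigenvalue A a /\ forall b, eigenvalue A b -> b <= a] (- a).
  split=> [|b /(eigenvalue_symP _ As)[y y0 Ay]]; first by apply/eigenvalue_symP => //; exists x.
  by have := amax y; rewrite Ay dotZr ler_pM2r// dot_gt0.
have [ea emax] := getI Aa; rewrite -/(max_eigenvalue A) in ea emax *.
by apply: le_anti; rewrite emax ?Aa.1//= Aa.2.
Qed.

(** Deflation, by induction on the rank: if [x] is a unit eigenvector for the
largest eigenvalue [a] then [A' := A - a x x^T] is nonnegative, of smaller rank
and kills [x]. A root [S] of [A'] also kills [x], so that
[S + sqrt a * x x^T] is a root of [A]. *)
Lemma psdmx_sqrt_exists n (A : 'M[R]_n) : psdmx A -> exists S, psdmx S /\ S *m S = A.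
Proof.
have [k] := ubnP (\rank A); elim: k A => // k IHk A rA Apsd.
have [As A0] := Apsd.
have [->|An0] := eqVneq A 0.
  by exists 0; rewrite mul0mx; split=> //; split=> [|x]; rewrite ?trmx0// mul0mx dot0r.
have n0 : (0 < n)%N.
  by case: n {IHk rA Apsd As A0} A An0 => // A /eqP[]; apply: flatmx0.
have [amax [x xx Ax]] := max_eigenvalueP n0 As.
set a := max_eigenvalue A in amax Ax.
have a0 : 0 < a.
  rewrite ltNge; apply: contra An0 => a0.
  suff Ay (y : 'cV[R]_n) : A *m y = 0.
    by apply/eqP/matrixP => i j; have /matrixP/(_ i 0) := Ay (delta_mx j 0); rewrite -colE !mxE.
  apply: psdmx_ker => //; apply: le_anti; rewrite A0 andbT.
  by apply: le_trans (amax y) _; rewrite mulr_le0_ge0// dot_ge0.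
pose A' := A - a *: (x *m x^T).
have A'E y : A' *m y = A *m y - (a * dot x y) *: x.
  rewrite mulmxBl -scalemxAl -mulmxA -scalerA; congr (_ - _ *: _).
  by rewrite /dot [x^T *m y]mx11_scalar mul_mx_scalar !mxE.
have A's : A'^T = A'.
  by rewrite linearB linearZ/= trmx_mul trmxK As.
have A'psd : psdmx A'.
  split=> // y; rewrite A'E !dotEs subr_ge0 (dotC y x).
  have := psd_cauchy_schwarz x y Apsd.
  rewrite (dot_symmx x y As) Ax !dotZr xx mulr1 (dotC y x) -(@ler_pM2l _ a)//.
  by rewrite exprMn; lra.
have A'x : A' *m x = 0 by rewrite A'E Ax xx mulr1 subrr.
have rA' : (\rank A' < k)%N.
  apply: leq_trans (_ : \rank A <= k)%N; last by rewrite -ltnS.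
  rewrite -mxrank_tr A's -(mxrank_tr A) As.
  have : (kermx A < kermx A')%MS.
    rewrite ltmxE; apply/andP; split.
      apply/rV_subP => v; rewrite !sub_kermx => /eqP vA; apply/eqP/trmx_inj.
      have Av : A *m v^T = 0 by rewrite -{1}As -trmx_mul vA trmx0.
      rewrite trmx_mul A's A'E Av trmx0 sub0r.
      have /eqP : a * dot x v^T = 0.
        by rewrite dotC -dotZr -Ax dot_mul As Av dot0l.
      by move=> /eqP->; rewrite scale0r oppr0.
    apply/negP => /rV_subP/(_ x^T); rewrite !sub_kermx.
    rewrite -{1}A's -trmx_mul A'x trmx0 eqxx => /(_ isT).
    rewrite -{1}As -trmx_mul Ax -trmx0 (inj_eq trmx_inj) scaler_eq0 gt_eqF//=.
    by rewrite -dot_eq0 xx oner_eq0.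
  move=> /rank_ltmx; rewrite !mxrank_ker; lia.
have [S [Spsd SS]] := IHk A' rA' A'psd.
have Sx : S *m x = 0.
  by apply/eqP; rewrite -dot_eq0 -{1}Spsd.1 -dot_mul mulmxA SS A'x dot0r.
exists (S + Num.sqrt a *: (x *m x^T)); split; first split.
- by rewrite linearD linearZ/= trmx_mul trmxK Spsd.1.
- move=> y; rewrite mulmxDl dotDr addr_ge0 ?Spsd.2//.
  rewrite -scalemxAl dotZr mulr_ge0 ?sqrtr_ge0// -mulmxA dot_mul.
  exact: dot_ge0.
- rewrite mulmxDl !mulmxDr SS -scalemxAr mulmxA Sx mul0mx scaler0 addr0.
  rewrite -!scalemxAl -scalemxAr scalerA -expr2 sqr_sqrtr ?ltW//.
  have -> : x *m x^T *m S = 0.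
    by rewrite -mulmxA -{1}Spsd.1 -trmx_mul Sx trmx0 mulmx0.
  have -> : x *m x^T *m (x *m x^T) = x *m x^T.
    rewrite -mulmxA (mulmxA x^T) [x^T *m x]mx11_scalar -/(dot x x) xx mul1mx//.
  by rewrite scaler0 add0r subrK.
Qed.

Lemma sqrtmxP n (A : 'M[R]_n) : psdmx A ->
  psdmx (sqrtmx A) /\ sqrtmx A *m sqrtmx A = A.
Proof. by move=> /psdmx_sqrt_exists[S AS]; exact: (@getI _ [set X | psdmx X /\ X *m X = A] S). Qed.

End Spectral.

(** * Bounds on the convergence factor *)

Section SpectralBounds.
Context {R : realType}.

Lemma invmx_sqr n (S : 'M[R]_n) : S \in unitmx ->
  invmx (S *m S) = invmx S *m invmx S.
Proof.
move=> Su; have SSu : S *m S \in unitmx by rewrite unitmx_mul Su.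
by rewrite -[RHS](mulKmx SSu) -!mulmxA (mulmxA S (invmx S)) mulmxV// mul1mx mulmxV// mulmx1.
Qed.

(** Kantorovich's inequality. Since [lo <= H <= up], the product
[(H - lo) (up - H)] is nonnegative; evaluating it at [y] with [g = sqrt H y]
bounds [g . H g + lo up (g . H^-1 g)] by [(lo + up) |g|^2], and the inequality
between the arithmetic and geometric means does the rest. *)
Lemma kantorovich n (H : 'M[R]_n) (lo up : R) g : pdmx H -> 0 < lo ->
    (forall x, lo * dot x x <= dot x (H *m x)) ->
    (forall x, dot x (H *m x) <= up * dot x x) ->
  4 * (lo * up) * (dot g (H *m g) * dot g (invmx H *m g)) <=
    (lo + up) ^+ 2 * dot g g ^+ 2.
Proof.
move=> Hpd lo0 Hlo Hup; have Hu := pdmx_unit Hpd; have [Hs H0] := Hpd.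
have [->|g0] := eqVneq g 0; first by rewrite !dot0l mul0r mulr0 expr0n mulr0.
have gg : 0 < dot g g by rewrite dot_gt0.
have up0 : 0 < up.
  by rewrite -(pmulr_lgt0 _ gg); apply: lt_le_trans (Hup g); apply: H0.
have [[Ts T0] TT] := sqrtmxP (pdmx_psdmx Hpd); set T := sqrtmx H in Ts T0 TT.
have Tu : T \in unitmx by move: Hu; rewrite -TT unitmx_mul => /andP[].
pose y := invmx T *m g; have gE : g = T *m y by rewrite mulKVmx.
have -> : dot g g = dot y (H *m y) by rewrite gE -{1}Ts -dot_mul mulmxA TT.
have -> : dot g (H *m g) = dot (H *m y) (H *m y).
  by rewrite -[X in _ = dot (X *m _) _]Hs -dot_mul gE -{1}Ts -dot_mul -!TT !mulmxA.
have -> : dot g (invmx H *m g) = dot y y.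
  rewrite gE -{1}Ts -dot_mul -TT invmx_sqr// -!mulmxA mulKmx// mulmxA mulmxV//.
  by rewrite mul1mx.
(* The form of [(H - lo) (up - H)] at [y] is nonnegative. *)
have HH : dot (H *m y) (H *m y) + lo * up * dot y y <= (lo + up) * dot y (H *m y).
  have P0 : psdmx (H - lo%:M).
    split=> [|x]; first by rewrite linearB/= Hs tr_scalar_mx.
    by rewrite mulmxBl mul_scalar_mx !dotEs subr_ge0.
  have bnd : forall x, dot x ((H - lo%:M) *m x) <= (up - lo) * dot x x.
    by move=> x; rewrite mulmxBl mul_scalar_mx !dotEs; have := Hup x; lra.
  have := psdmx_sqr_le y P0 bnd; rewrite mulmxBl mul_scalar_mx !dotEs (dotC (H *m y) y).
  move: (dot (H *m y) _) (dot y y) (dot y (H *m y)) => a b e; clear; lra.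
have a0 := dot_ge0 (H *m y); have b0 := dot_ge0 y.
move: (dot (H *m y) _) (dot y y) (dot y (H *m y)) a0 b0 HH => a b e a0 b0 HH.
rewrite -exprMn; apply: (@le_trans _ _ ((a + lo * up * b) ^+ 2)).
  by have := sqr_ge0 (a - lo * up * b); lra.
have ab0 : 0 <= a + lo * up * b by rewrite addr_ge0 ?mulr_ge0// ltW.
by rewrite ler_pXn2r// nnegrE; exact: le_trans HH.
Qed.

(** The substitution [x = S^-1 g] turns the Rayleigh quotient of
[S H^-1 S] into the ratio of the forms of [H^-1] and [A^-1]: its extreme values
are the best constants in [lo A^-1 <= H^-1 <= up A^-1]. *)
Lemma conj_sqrt_forms n (A H : 'M[R]_n) g (S := sqrtmx A)
    (K := S *m invmx H *m S) (x := invmx S *m g) : pdmx A ->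
  dot x x = dot g (invmx A *m g) /\ dot x (K *m x) = dot g (invmx H *m g).
Proof.
move=> Apd; have [[Ss _] SS] := sqrtmxP (pdmx_psdmx Apd); rewrite -/S in Ss SS.
have Su : S \in unitmx by have := pdmx_unit Apd; rewrite -SS unitmx_mul => /andP[].
have Sis := invmx_sym Ss; split.
  by rewrite /x -{1}Sis -dot_mul mulmxA -SS invmx_sqr.
rewrite /K /x -!mulmxA mulKVmx// -{1}Sis -dot_mul mulKmx//.
Qed.

(** The upper bound on [q] follows from [C <= A^-1 <= H^-1 / kappa_lo]. For the
lower one, testing the maximality of [C g] on multiples of [g] itself gives
[|g|^4 <= (g . C g) (g . A g)]; then [A <= kappa_up H], and Kantorovich's
inequality compares [(g . H g) (g . H^-1 g)] with [|g|^4]. *)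
Lemma theta_bounds n m (H A : 'M[R]_n) (D : 'M[R]_(n, m)) g
    (K := sqrtmx A *m invmx H *m sqrtmx A)
    (q := dot g (mm_C A D *m g) / dot g (invmx H *m g)) :
    (0 < n)%N -> pdmx H -> pdmx A -> loewner_le H A -> ranmx D g ->
  [/\ 1 <= min_eigenvalue K, 0 < max_eigenvalue K,
      0 < min_eigenvalue H, 0 < max_eigenvalue H &
      g != 0 -> (max_eigenvalue K)^-1 *
        (1 - ((max_eigenvalue H - min_eigenvalue H)
             / (max_eigenvalue H + min_eigenvalue H)) ^+ 2) <= q
      <= (min_eigenvalue K)^-1].
Proof.
move=> n0 Hpd Apd HA Dg.
have [Hs Hgt0] := Hpd; have [As Agt0] := Apd.
have [[Ss _] SS] := sqrtmxP (pdmx_psdmx Apd).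
have Au := pdmx_unit Apd; have Hu := pdmx_unit Hpd.
have Su : sqrtmx A \in unitmx by move: Au; rewrite -{1}SS unitmx_mul => /andP[].
have Ks : K^T = K by rewrite /K !trmx_mul Ss (invmx_sym Hs) mulmxA.
have [Klo [x xx Kx]] := min_eigenvalueP n0 Ks.
have [Kup _] := max_eigenvalueP n0 Ks.
have [Hlo [y yy Hy]] := min_eigenvalueP n0 Hs.
have [Hup [z zz Hz]] := max_eigenvalueP n0 Hs.
have nz (v : 'cV[R]_n) : dot v v = 1 -> v != 0 by move=> vv; rewrite -dot_gt0 vv.
have lo0 : 0 < min_eigenvalue H.
  by have := Hgt0 y (nz y yy); rewrite Hy dotZr yy mulr1.
have up0 : 0 < max_eigenvalue H.
  by have := Hgt0 z (nz z zz); rewrite Hz dotZr zz mulr1.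
have HA' v : dot v (H *m v) <= dot v (A *m v).
  by have := HA.2 v; rewrite mulmxBl dotDr dotNr subr_ge0.
have klo1 : 1 <= min_eigenvalue K.
  have [E1 E2] := conj_sqrt_forms H (sqrtmx A *m x) Apd.
  have := invmx_antitone (sqrtmx A *m x) Hpd Apd HA'.
  by rewrite -E1 -E2 (mulKmx Su) xx Kx dotZr xx mulr1.
have kup1 : 1 <= max_eigenvalue K.
  apply: le_trans klo1 _; have := Kup x.
  by rewrite Kx dotZr xx !mulr1.
split; [by []|exact: lt_le_trans ltr01 kup1|by []|by []|move=> g0].
have gg : 0 < dot g g by rewrite dot_gt0.
have gHg := Hgt0 g g0; have gHVg := (pdmx_inv Hpd).2 g g0.
have gAg := Agt0 g g0.
apply/andP; split; last first.
  rewrite ler_pdivrMr// (ler_pdivlMl _ _ (lt_le_trans ltr01 klo1)).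
  have [E1 E2] := conj_sqrt_forms H g Apd.
  have := Klo (invmx (sqrtmx A) *m g); rewrite E1 E2; apply: le_trans.
  rewrite (ler_pM2l (lt_le_trans ltr01 klo1)); exact: mm_C_le_inv.
set k := max_eigenvalue K in Kup kup1 *; have k0 : 0 < k by exact: lt_le_trans ltr01 kup1.
have AkH v : dot v (A *m v) <= k * dot v (H *m v).
  have kAVpd : pdmx (k *: invmx A).
    have [AVs AV0] := pdmx_inv Apd.
    by split=> [|w w0]; rewrite ?linearZ/= ?AVs// -scalemxAl dotZr mulr_gt0 ?AV0.
  have kAH w : dot w (invmx H *m w) <= dot w (k *: invmx A *m w).
    have [E1 E2] := conj_sqrt_forms H w Apd.
    by have := Kup (invmx (sqrtmx A) *m w); rewrite E1 E2 -scalemxAl dotZr.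
  have := invmx_antitone v (pdmx_inv Hpd) kAVpd kAH.
  rewrite invmxZ ?pdmx_unit// !invmxK.
  by rewrite -scalemxAl dotZr ler_pdivrMl.
have Clow : dot g g ^+ 2 <= dot g (mm_C A D *m g) * dot g (A *m g).
  rewrite -ler_pdivrMr//.
  (* The multiple of [g] that maximises [2 g . x - x . A x]. *)
  have Dt : ranmx D ((dot g g / dot g (A *m g)) *: g).
    by case: Dg => w _ Dw; exists ((dot g g / dot g (A *m g)) *: w); rewrite // -scalemxAr Dw.
  apply: le_trans _ (mm_C_max g Apd Dt); rewrite (mulmxEs A) !dotEs le_eqVlt.
  by apply/orP; left; apply/eqP; field; rewrite gt_eqF.
have Kan := kantorovich g Hpd lo0 Hlo Hup.
have gCg : 0 <= dot g (mm_C A D *m g).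
  by rewrite -mm_C_quad//; exact: (pdmx_psdmx Apd).2.
set lo := min_eigenvalue H in lo0 Kan *; set up := max_eigenvalue H in up0 Kan *.
have -> : 1 - ((up - lo) / (up + lo)) ^+ 2 = 4 * (lo * up) / (lo + up) ^+ 2.
  by field; rewrite gt_eqF ?addr_gt0.
have s0 : 0 < (lo + up) ^+ 2 by rewrite exprn_gt0// addr_gt0.
rewrite ler_pdivlMr//.
have AkHg := AkH g.
move: (dot g g) (dot g (mm_C _ _ *m g)) (dot g (A *m g)) (dot g (H *m g))
  (dot g (invmx H *m g)) gg Clow Kan gCg gHg gHVg gAg AkHg s0.
move: ((lo + up) ^+ 2) (lo * up) (mulr_gt0 lo0 up0) k0.
move=> s p p0 k0 e c a b d e0 ec kan c0 b0 d0 a0 abk s0.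
have -> : k^-1 * (4 * p / s) * d = 4 * p * d / (k * s).
  by field; rewrite !gt_eqF.
rewrite ler_pdivrMr ?mulr_gt0// -(ler_pM2r b0).
have ecb : e ^+ 2 <= c * (k * b) by apply: le_trans ec _; rewrite ler_wpM2l.
have secb : s * e ^+ 2 <= s * (c * (k * b)) by rewrite ler_pM2l.
by move: kan secb; clear; lra.
Qed.

End SpectralBounds.

(** * Euclidean, maximum and spectral norms *)

Section Norms.
Context {R : realType}.

Lemma coord_le_enorm n (x : 'cV[R]_n) i : `|x i 0| <= enorm x.
Proof.
rewrite -(@ler_pXn2r _ 2) ?nnegrE ?enorm_ge0// enorm_sqr real_normK ?num_real//.
rewrite dotE (bigD1 i)//= -expr2 lerDl sumr_ge0// => k _.
by rewrite -expr2 sqr_ge0.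
Qed.

Lemma mx_norm_le m n (A : 'M[R]_(m, n)) e : 0 <= e ->
  `|A| <= e <-> forall i j, `|A i j| <= e.
Proof.
move=> e0; rewrite /Num.Def.normr/= mx_normrE; split=> [/bigmax_leP[_ Ae] i j|Ae].
  exact: (Ae (i, j)).
by apply/bigmax_leP; split=> // -[i j] _; exact: Ae.
Qed.

(** Each product [x_i x_j] is at most the mean of [x_i ^ 2] and [x_j ^ 2], and
every square occurs [n] times. *)
Lemma form_le_norm n (A : 'M[R]_n) x :
  `|dot x (A *m x)| <= n%:R * `|A| * dot x x.
Proof.
have := (mx_norm_le A (normr_ge0 A)).1 (lexx _); set e := `|A| => Ae.
rewrite dotE; apply: le_trans (ler_norm_sum _ _ _) _.
apply: (@le_trans _ _ (\sum_(i < n) \sum_(j < n)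
    e * (2^-1 * (x i 0 * x i 0 + x j 0 * x j 0)))).
  apply: ler_sum => i _; rewrite normrM mxE mulrC.
  apply: le_trans (ler_wpM2r (normr_ge0 _) (ler_norm_sum _ _ _)) _.
  rewrite mulr_suml; apply: ler_sum => j _.
  rewrite normrM -mulrA ler_pM ?mulr_ge0//.
  rewrite -!expr2 -[x i 0 ^+ 2]real_normK ?num_real// -[x j 0 ^+ 2]real_normK ?num_real//.
  by have := sqr_ge0 (`|x j 0| - `|x i 0|); lra.
rewrite -(@eq_bigr _ _ _ _ _ _ (fun i => e * (2^-1 * (n%:R * (x i 0 * x i 0) + dot x x)))).
  rewrite -mulr_sumr -mulr_sumr big_split/= -mulr_sumr -dotE sumr_const card_ord -mulr_natl.
  by rewrite le_eqVlt; apply/orP; left; apply/eqP; field.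
move=> i _; rewrite -mulr_sumr -mulr_sumr big_split/= sumr_const card_ord mulr_natl.
by rewrite -dotE.
Qed.

Lemma enorm_ball n (e : R) (x : 'cV[R]_n) :
  0 < e -> enorm x < e -> ball (0 : 'cV[R]_n) e x.
Proof.
move=> e0 xe; rewrite -ball_normE /= sub0r normrN; apply: le_lt_trans xe.
by apply/mx_norm_le => [|i j]; rewrite ?enorm_ge0// (ord1 j) coord_le_enorm.
Qed.

Lemma enormD n (x y : 'cV[R]_n) : enorm (x + y) <= enorm x + enorm y.
Proof.
rewrite -(@ler_pXn2r _ 2) ?nnegrE ?addr_ge0 ?enorm_ge0//.
rewrite sqrrD !enorm_sqr !dotEs (dotC y x).
have := le_trans (ler_norm _) (dot_le_enorm x y); lra.
Qed.

Lemma enormZ n a (x : 'cV[R]_n) : enorm (a *: x) = `|a| * enorm x.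
Proof. by rewrite /enorm !dotEs mulrA -expr2 sqrtrM ?sqr_ge0// sqrtr_sqr. Qed.

Lemma enorm_gt0 n (x : 'cV[R]_n) : (0 < enorm x) = (x != 0).
Proof. by rewrite sqrtr_gt0 dot_gt0. Qed.

Lemma enorm_le_norm n (x : 'cV[R]_n) : enorm x <= n%:R * `|x|.
Proof.
have c0 : 0 <= n%:R * `|x| by rewrite mulr_ge0.
rewrite -(@ler_pXn2r _ 2) ?nnegrE ?enorm_ge0// enorm_sqr dotE.
apply: (@le_trans _ _ (\sum_(i < n) `|x| ^+ 2)).
  apply: ler_sum => i _; rewrite -expr2 -[leLHS]real_normK ?num_real//.
  rewrite ler_pXn2r ?nnegrE//.
  exact: (mx_norm_le x (normr_ge0 x)).1 (lexx _) i 0.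
rewrite sumr_const card_ord -[leLHS]mulr_natl exprMn ler_wpM2r ?sqr_ge0//.
by rewrite -natrX ler_nat; case: n {x c0} => // n; rewrite expnS leq_pmulr// expn1.
Qed.

(** The supremum that defines the spectral norm is that of a bounded set, by the
bound on the form of [A^T *m A]; so it is an upper bound. *)
Lemma enorm_mulmx_le n (A : 'M[R]_n) x : enorm (A *m x) <= spectral_norm A * enorm x.
Proof.
pose S := [set enorm (A *m x) | x in [set x : 'cV[R]_n | enorm x <= 1]].
have Sub : has_ubound S.
  exists (Num.sqrt (n%:R * `|A^T *m A|)) => _ [y /= y1 <-].
  rewrite /enorm ler_sqrt ?mulr_ge0// -[A in dot (A *m _) _]trmxK -dot_mul mulmxA.
  apply: le_trans (ler_norm _) _; apply: le_trans (form_le_norm _ _) _.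
  by rewrite -[leRHS]mulr1 ler_wpM2l ?mulr_ge0// -enorm_sqr expr_le1// enorm_ge0.
have [->|x0] := eqVneq x 0.
  by rewrite mulmx0 /enorm dot0r sqrtr0 mulr0.
have ex0 : 0 < enorm x by rewrite enorm_gt0.
rewrite -ler_pdivrMr// mulrC -{1}(gtr0_norm (_ : 0 < (enorm x)^-1)) ?invr_gt0//.
rewrite -enormZ scalemxAr; apply: (@ub_le_sup _ S) => //.
exists ((enorm x)^-1 *: x) => //=.
by rewrite enormZ gtr0_norm ?invr_gt0// mulVf// gt_eqF.
Qed.

Lemma form_le_spectral n (A : 'M[R]_n) x :
  `|dot x (A *m x)| <= spectral_norm A * enorm x ^+ 2.
Proof.
apply: le_trans (dot_le_enorm _ _) _; rewrite mulrC expr2 mulrA.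
by rewrite ler_wpM2r ?enorm_ge0// enorm_mulmx_le.
Qed.

Lemma spectral_norm_ge0 n (A : 'M[R]_n) : (0 < n)%N -> 0 <= spectral_norm A.
Proof.
case: n A => // n A _; have := enorm_mulmx_le A (delta_mx 0 0).
have -> : enorm (delta_mx 0 0 : 'cV[R]_n.+1) = 1.
  rewrite /enorm dotE (bigD1 ord0)//= big1 => [|i i0].
    by rewrite !mxE !eqxx mulr1 addr0 sqrtr1.
  by rewrite !mxE (negPf i0) mul0r.
by rewrite mulr1; apply: le_trans; exact: enorm_ge0.
Qed.

Lemma cvg_form n (An : nat -> 'M[R]_n) (A : 'M[R]_n) (e : R) : An @ \oo --> A -> 0 < e ->
  \forall k \near \oo, forall v, `|dot v ((An k - A) *m v)| <= e * dot v v.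
Proof.
move=> AnA e0; have e'0 : 0 < e / n.+1%:R by rewrite divr_gt0.
have /cvgrPdist_le /(_ _ e'0) := AnA; apply: filterS => k kA v.
apply: le_trans (form_le_norm _ _) _; rewrite ler_wpM2r ?dot_ge0//.
rewrite distrC in kA; apply: (@le_trans _ _ (n%:R * (e / n.+1%:R))).
  by rewrite ler_wpM2l.
rewrite mulrCA -[leRHS]mulr1 (ler_wpM2l (ltW e0))//.
by rewrite ler_pdivrMr// mul1r ler_nat.
Qed.

Lemma cvg_enorm_bounded n (vn : nat -> 'cV[R]_n) (v : 'cV[R]_n) : vn @ \oo --> v ->
  \forall k \near \oo, enorm (vn k) <= enorm v + n%:R.
Proof.
move=> /cvgrPdist_le /(_ 1 ltr01); apply: filterS => k kv.
rewrite -[vn k](subrK v) addrC; apply: le_trans (enormD _ _) _; rewrite lerD2l.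
apply: le_trans (enorm_le_norm _) _; rewrite -[leRHS]mulr1 ler_wpM2l//.
by rewrite distrC.
Qed.

End Norms.

(** * Gradients, Hessians and second-order expansions *)

Section Calculus.
Context {R : realType}.

(** Both derivatives are limits of the same difference quotient. *)
Lemma is_derive_line (V W : normedModType R) (f : V -> W) x d (t : R) df :
  is_derive t 1 (fun s : R => f (x + s *: d)) df <->
  is_derive (x + t *: d) d f df.
Proof.
pose g (s : R) := f (x + s *: d).
have E : (fun h : R => h^-1 *: ((g \o shift t) (h *: (1 : R)) - g t)) =
  (fun h => h^-1 *: ((f \o shift (x + t *: d)) (h *: d) - f (x + t *: d))).
  apply/funext => h /=; congr (_ *: (f _ - _)).
  by rewrite [h *: (1 : R)]mulr1 scalerDl addrCA addrA addrC addrA.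
rewrite -/g; split=> -[].
  by rewrite /derivable /derive E => fd fE; apply: DeriveDef.
by rewrite /derivable /derive -E => fd fE; apply: DeriveDef.
Qed.

Lemma is_derive_line0 (V W : normedModType R) (f : V -> W) x d df :
  is_derive (0 : R) 1 (fun s : R => f (x + s *: d)) df <-> is_derive x d f df.
Proof. by rewrite is_derive_line scale0r addr0. Qed.

(** The mean value theorem is applied to [f] minus its first-order part minus
[m t^2 / 2], and then to [f']. *)
Lemma taylor2_ge (f f' f'' : R -> R) m :
    (forall t : R, is_derive t 1 f (f' t)) -> (forall t : R, is_derive t 1 f' (f'' t)) ->
    (forall t, 0 <= t <= 1 -> m <= f'' t) ->
  f 0 + f' 0 + 2^-1 * m <= f 1.
Proof.
move=> df df' mf.
pose g t := f t - f' 0 * t - (2^-1 * m) * t ^+ 2.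
have dg t : is_derive t (1 : R) g (f' t - f' 0 - m * t).
  have dft := df t.
  apply: is_derive_eq.
  by rewrite /GRing.scale/=; field.
have cont (h h' : R -> R) : (forall t : R, is_derive t 1 h (h' t)) ->
    forall A, {within A, continuous h}.
  move=> dh A; apply: continuous_subspaceT => t.
  by apply/differentiable_continuous/derivable1_diffP; have [] := dh t.
have [c /[!in_itv]/= /andP[c0 c1] gc] := MVT (@ltr01 R) (fun t _ => dg t) (cont _ _ dg _).
have [d /[!in_itv]/= /andP[d0 dc] fd] := MVT c0 (fun t _ => df' t) (cont _ _ df' _).
have md : m <= f'' d by apply: mf; rewrite (ltW d0) (le_trans (ltW dc)) ?ltW.
move: gc; rewrite /g; have : m * c <= f'' d * c by rewrite ler_pM2r.
lra.
Qed.

Context {N : nat}.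
Implicit Types (f : 'cV[R]_N -> R) (x d : 'cV[R]_N).

(** The differential is linear and [grad] collects its values on the basis. *)
Lemma derive_grad f x d : differentiable f x -> 'D_d f x = dot (grad f x) d.
Proof.
move=> df; rewrite deriveE// {1}(matrix_sum_delta d) linear_sum dotE.
apply: eq_bigr => i _; rewrite big_ord1 linearZ/= mxE /partial deriveE// mulrC.
by [].
Qed.

Lemma is_derive_grad_line f x d (t : R) : (forall y, differentiable f y) ->
  is_derive t 1 (fun s : R => f (x + s *: d)) (dot (grad f (x + t *: d)) d).
Proof.
move=> df; apply/is_derive_line; rewrite -derive_grad//.
exact/derivableP/diff_derivable.
Qed.

Lemma differentiable_partial f i x : differentiable (grad f) x ->
  differentiable (partial f i) x.
Proof.
move=> dg; have -> : partial f i = (fun v : 'cV[R]_N => v i 0) \o grad f.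
  by apply/funext => y; rewrite /= mxE.
apply: differentiable_comp => //; exact: differentiable_coord.
Qed.

Lemma is_derive_hess_line f x d (t : R) : (forall y, differentiable (grad f) y) ->
  is_derive t 1 (fun s : R => dot (grad f (x + s *: d)) d)
    (dot d (hess f (x + t *: d) *m d)).
Proof.
move=> dg.
have di i : is_derive t 1 (fun s : R => partial f i (x + s *: d))
    (\sum_j hess f (x + t *: d) i j * d j 0).
  apply: is_derive_eq.
    by apply: is_derive_grad_line => y; exact: differentiable_partial.
  by rewrite dotE; apply: eq_bigr => j _; rewrite !mxE.
have := @is_derive_sum R R R N (fun i (s : R) => d i 0 * partial f i (x + s *: d))
    t 1 _ (fun i => is_deriveZ (d i 0) (di i)).
rewrite [X in is_derive _ _ X](_ : _ = (fun s : R => dot (grad f (x + s *: d)) d)).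
  move=> dsum; apply: (is_derive_eq dsum).
  by rewrite dotE; apply: eq_bigr => i _; rewrite [in RHS]mxE.
apply/funext => s; rewrite dotE fct_sumE; apply: eq_bigr => i _.
by rewrite mxE mulrC.
Qed.

Lemma taylor_form_ge f x d m : C2 f ->
    (forall t : R, 0 <= t <= 1 -> m <= dot d (hess f (x + t *: d) *m d)) ->
  f x + dot (grad f x) d + 2^-1 * m <= f (x + d).
Proof.
move=> [df dg _] mf.
have := taylor2_ge (fun t => @is_derive_grad_line f x d t df)
  (fun t => @is_derive_hess_line f x d t dg) mf.
by rewrite scale0r addr0 scale1r.
Qed.

Lemma taylor_form_le f x d m : C2 f ->
    (forall t : R, 0 <= t <= 1 -> dot d (hess f (x + t *: d) *m d) <= m) ->
  f (x + d) <= f x + dot (grad f x) d + 2^-1 * m.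
Proof.
move=> [df dg _] mf.
have mfN (t : R) : 0 <= t <= 1 -> - m <= - dot d (hess f (x + t *: d) *m d).
  by rewrite lerN2; exact: mf.
have d1 t : is_derive t (1 : R) (fun s : R => - f (x + s *: d))
    (- dot (grad f (x + t *: d)) d) := is_deriveN (@is_derive_grad_line f x d t df).
have d2 t : is_derive t (1 : R) (fun s : R => - dot (grad f (x + s *: d)) d)
    (- dot d (hess f (x + t *: d) *m d)) := is_deriveN (@is_derive_hess_line f x d t dg).
by have := taylor2_ge d1 d2 mfN; rewrite scale0r addr0 scale1r; lra.
Qed.

Lemma trmx_continuous m n : continuous (@trmx R m n).
Proof.
move=> v s /nbhs_ballP[e e0 es]; apply/nbhs_ballP; exists e => // w [_ vw].
by apply: es; split=> // i j; rewrite !mxE; exact: vw.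
Qed.

Lemma cube_compact (M : R) : compact [set x : 'cV[R]_N | forall i, `|x i 0| <= M].
Proof.
have -> : [set x : 'cV[R]_N | forall i, `|x i 0| <= M] =
    trmx @` [set v : 'rV[R]_N | forall i, `[- M, M]%classic (v 0 i)].
  apply/seteqP; split=> [x /= xM|_ [v /= vM <-] i].
    exists x^T; last by rewrite trmxK.
    by move=> i; rewrite /= mxE in_itv/= -ler_norml.
  by have := vM i; rewrite /= mxE in_itv/= -ler_norml.
apply: continuous_compact; first exact/continuous_subspaceT/trmx_continuous.
by apply: (@rV_compact R N (fun=> `[- M, M]%classic)) => i; exact: segment_compact.
Qed.

(** Heine's theorem for the Hessian on bounded sets, stated for quadratic forms
because that is how Loewner comparisons use it. *)
Lemma hess_unif_continuous f M rho : continuous (hess f) -> 0 < rho ->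
  exists2 delta, 0 < delta & forall x d, enorm x <= M -> enorm d <= delta ->
    forall v, `|dot v ((hess f (x + d) - hess f x) *m v)| <= rho * dot v v.
Proof.
move=> cH rho0.
(* The form of a matrix is at most [N] times its largest entry, relative to [dot v v];
   [N.+1] is nonzero. *)
pose e := rho / N.+1%:R.
have e0 : 0 < e by rewrite divr_gt0.
pose P (delta : R) x := forall d, enorm d <= delta -> `|hess f (x + d) - hess f x| <= e.
have HP : \forall delta \near 0^'+, [set x : 'cV[R]_N | forall i, `|x i 0| <= M] `<=` P delta.
  have /compact_near_coveringP cov := @cube_compact M; apply: (cov _ _ P _) => x _.
  have /cvgrPdist_lt /(_ (e / 2)) := cH x.
  move=> /(_ (divr_gt0 e0 (ltr0Sn _ 1))) /nbhs_ballP[r /= r0 Hr].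
  have r20 : 0 < r / 2 by rewrite divr_gt0.
  near=> x' delta => /= d dd.
  have x'x : ball x (r / 2) x' by near: x'; exact: nbhsx_ballx.
  have x'dx : ball x r (x' + d).
    rewrite [r]splitr -ball_normE/= opprD addrA.
    apply: le_lt_trans (ler_normB _ _) _; rewrite ltrD//.
    have : ball (0 : 'cV[R]_N) (r / 2) d.
      apply: enorm_ball => //; apply: le_lt_trans dd _.
      by near: delta; exact: nbhs_right_lt.
    by rewrite -ball_normE/= sub0r normrN.
  have {}x'x : ball x r x'.
    by apply: le_ball x'x; rewrite ler_pdivrMr// ler_peMr ?ler1n// ltW.
  have H1 := Hr _ x'dx; have H2 := Hr _ x'x.
  rewrite [e]splitr -(subrKA (hess f x)); apply: le_trans (ler_normD _ _) _.
  by apply: lerD; [rewrite distrC; exact: (ltW H1)|exact: (ltW H2)].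
case/nbhs_ballP: HP => r /= r0 Hr; have r20 : 0 < r / 2 by rewrite divr_gt0.
exists (r / 2) => // x d xM dd v.
have HPd : [set x : 'cV[R]_N | forall i, `|x i 0| <= M] `<=` P (r / 2).
  apply: Hr => //; rewrite -ball_normE/= sub0r normrN gtr0_norm//.
  by rewrite ltr_pdivrMr// ltr_pMr// ltr1n.
have {HPd}HP : P (r / 2) x.
  by apply: HPd => i; apply: le_trans xM; exact: coord_le_enorm.
apply: le_trans (form_le_norm _ _) _; rewrite ler_wpM2r ?dot_ge0//.
apply: (@le_trans _ _ (N%:R * e)); first by rewrite ler_wpM2l// HP.
rewrite /e mulrCA -[leRHS]mulr1 (ler_wpM2l (ltW rho0))//.
by rewrite ler_pdivrMr// mul1r ler_nat.
Unshelve. all: by end_near. Qed.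

Lemma convex_functionE f x y t : convex_function [set: 'cV[R]_N] f ->
  0 <= t <= 1 -> f (t *: x + (1 - t) *: y) <= t * f x + (1 - t) * f y.
Proof.
move=> cf /andP[t0 t1].
by have := cf (Itv01 t0 t1) x y (mem_set I) (mem_set I).
Qed.

(** If the form of the Hessian were negative at [d], by continuity it would stay
negative around [x], and the second-order expansions at [x + s d] and [x - s d]
would contradict midpoint convexity. *)
Lemma convex_hess_ge0 f x d : C2 f -> convex_function [set: 'cV[R]_N] f ->
  0 <= dot d (hess f x *m d).
Proof.
move=> C2f cf; rewrite leNgt; apply/negP => neg.
have d0 : 0 < dot d d.
  by rewrite dot_gt0; apply: contraTneq neg => ->; rewrite dot0l ltxx.
set q := dot d _ in neg.
(* A perturbation of size [rho] leaves at least half of the negative form. *)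
pose rho := - q / (2 * dot d d).
have rho0 : 0 < rho by rewrite divr_gt0 ?mulr_gt0// oppr_gt0.
have [delta delta0 H] := hess_unif_continuous (enorm x) (let: And3 _ _ c := C2f in c) rho0.
have ed0 : 0 < enorm d by rewrite sqrtr_gt0.
have {}H d' := H x d' (lexx _).
move: (hess f x) @q neg @rho rho0 H => Hx q neg rho rho0 H.
have [s s0 sd] : exists2 s, 0 < s & s * enorm d = delta.
  by exists (delta / enorm d); [rewrite divr_gt0|rewrite divfK// gt_eqF].
(* [a] is a sign, so that both directions are treated at once. *)
have dir a : a ^+ 2 = 1 ->
    f (x + (a * s) *: d) <= f x + a * s * dot (grad f x) d + 2^-1 * (s ^+ 2 * (q / 2)).
  move=> a2; have a1 : `|a| = 1.
    by apply/eqP; rewrite -(@eqrXn2 _ 2)// expr1n real_normK ?num_real// a2.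
  rewrite -dotZr; apply: taylor_form_le => // t /andP[t0 t1].
  have := H (t *: ((a * s) *: d)) _ d.
  rewrite scalerA {1}/enorm !dotEs mulrA -expr2 sqrtrM ?sqr_ge0// sqrtr_sqr.
  rewrite -/(enorm d) !normrM a1 mul1r (ger0_norm t0) (gtr0_norm s0) -mulrA sd.
  have td : t * delta <= delta by rewrite ler_piMl// ltW.
  move=> /(_ td).
  move: (hess f (x + _)) => Ht.
  rewrite mulmxBl dotDr dotNr -/q ler_norml => /andP[_ qq'].
  rewrite -scalemxAr dotZr mulrA -expr2 exprMn a2 mul1r ler_pM2l ?exprn_gt0//.
  have -> : q / 2 = q + rho * dot d d by rewrite /rho; field; rewrite gt_eqF.
  by rewrite -lerBlDl.
have D1 := dir 1 (expr1n _ _); have D2 := dir (-1) (etrans (sqrrN 1) (expr1n _ _)).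
have := @convex_functionE f (x + (1 * s) *: d) (x + (- 1 * s) *: d) (2^-1) cf.
have -> : 2^-1 *: (x + (1 * s) *: d) + (1 - 2^-1) *: (x + (- 1 * s) *: d) = x.
  have -> : 1 - 2^-1 = 2^-1 :> R by field.
  rewrite -scalerDr mul1r mulN1r scaleNr addrACA subrr addr0 -mulr2n.
  by rewrite -scalerMnr scalerMnl -mulr_natr mulVf// scale1r.
have -> : 0 <= (2^-1 : R) <= 1 by lra.
move=> /(_ isT) cv.
have sq : s ^+ 2 * q < 0 by rewrite pmulr_rlt0 ?exprn_gt0.
move: cv D1 D2 sq; move: (f x) (f _) (f _) (dot _ _) => *; lra.
Qed.

Section PlsCost.
Variables (Q : 'M[R]_N) (q : 'cV[R]_N) (Psi : 'cV[R]_N -> R).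
Hypothesis Qs : Q^T = Q.
Hypothesis dPsi : forall x, differentiable Psi x.

Lemma pls_cost_expand x d : pls_cost Q q Psi (x + d) =
  (pls_cost Q q Psi x - Psi x) + dot (Q *m x - q) d + 2^-1 * dot d (Q *m d) + Psi (x + d).
Proof.
rewrite /pls_cost !(mulmxEs Q) !dotEs (dot_symmx x d Qs) (dotC (Q *m x) d); by field.
Qed.

Lemma is_derive_pls_cost x d :
  is_derive x d (pls_cost Q q Psi) (dot (Q *m x - q + grad Psi x) d).
Proof.
apply/is_derive_line0.
have dP := @is_derive_grad_line Psi x d 0 dPsi.
have -> : (fun s : R => pls_cost Q q Psi (x + s *: d)) = (fun s =>
  (pls_cost Q q Psi x - Psi x) + s * dot (Q *m x - q) d
    + s ^+ 2 * (2^-1 * dot d (Q *m d)) + Psi (x + s *: d)).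
  apply/funext => s; rewrite pls_cost_expand !(mulmxEs Q) !dotEs; congr (_ + _); ring.
apply: is_derive_eq.
rewrite (scale0r d) addr0 !(dotDl d) /GRing.scale/=.
ring.
Qed.

Lemma grad_pls_cost x : grad (pls_cost Q q Psi) x = Q *m x - q + grad Psi x.
Proof.
apply/matrixP => i j; rewrite (ord1 j) mxE /partial.
rewrite (@derive_val _ _ _ _ _ _ _ (is_derive_pls_cost x (delta_mx i 0))) dotC dotE.
rewrite (bigD1 i)//= big1 ?mxE ?eqxx ?mul1r ?addr0// => k ki.
by rewrite mxE (negPf ki) mul0r.
Qed.

Hypothesis ddPsi : forall x, differentiable (grad Psi) x.

Lemma hess_pls_cost x : hess (pls_cost Q q Psi) x = Q + hess Psi x.
Proof.
apply/matrixP => i j; rewrite !mxE.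
have -> : partial (pls_cost Q q Psi) i =
   (fun y => (Q *m y - q) i 0 + partial Psi i y).
  apply/funext => y; have /matrixP/(_ i 0) := grad_pls_cost y.
  by rewrite !mxE.
rewrite /partial; apply: derive_val; set d := delta_mx j 0.
apply/is_derive_line0.
have dP : is_derive (0 : R) 1 (fun s => partial Psi i (x + s *: d)) ('D_d (partial Psi i) x).
  apply/is_derive_line; rewrite scale0r addr0.
  by apply/derivableP/diff_derivable/differentiable_partial.
have -> : (fun s : R => (Q *m (x + s *: d) - q) i 0 + partial Psi i (x + s *: d)) =
   (fun s : R => ((Q *m x - q) i 0 + s * Q i j) + partial Psi i (x + s *: d)).
  apply/funext => s; congr (_ + _); rewrite !(mulmxEs Q) -colE !mxE; ring.
apply: is_derive_eq.
by rewrite /GRing.scale/= /partial; ring.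
Qed.

End PlsCost.

End Calculus.

(** * Descent up to a summable perturbation *)

Section Summability.
Context {R : realType}.

Lemma series_shift_bounded (a : nat -> R) : (forall n, 0 <= a n) ->
  cvgn (series a) -> exists S, forall m n, \sum_(0 <= k < n) a (k + m)%N <= S.
Proof.
move=> a0 ca; exists (limn (series a)) => m n.
have nd : nondecreasing_seq (series a).
  by apply/nondecreasing_seqP => k; rewrite seriesSr lerDl.
apply: le_trans (nondecreasing_cvgn_le nd ca (n + m)%N).
rewrite /series/= [leRHS](@big_cat_nat _ _ _ m)//= ?leq_addl//.
have -> : \sum_(m <= i < n + m) a i = \sum_(0 <= i < n) a (i + m)%N.
  by rewrite -{1}[m]add0n big_addn addnK.
by rewrite lerDr; exact: sumr_ge0.
Qed.

(** Telescoping bounds the partial sums of [e] by [u 0 - m + S], so that the series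
of [e] converges. *)
Lemma descent_cvg0 (u e a : nat -> R) m S : (forall n, 0 <= e n) ->
    (forall n, u n.+1 <= u n - e n + a n) -> (forall n, m <= u n) ->
    (forall n, \sum_(0 <= k < n) a k <= S) -> e @ \oo --> 0.
Proof.
move=> e0 ue mu aS; apply: cvg_series_cvg_0.
apply: nondecreasing_is_cvgn.
  by apply/nondecreasing_seqP => k; rewrite seriesSr lerDl.
exists (u 0%N - m + S) => _ [n _ <-].
have H : series e n <= u 0%N - u n + \sum_(0 <= k < n) a k.
  elim: n => [|n IH]; first by rewrite /series/= !big_nil subrr addr0.
  by rewrite seriesSr big_nat_recr//=; have := ue n; lra.
by apply: le_trans H _; have := mu n; have := aS n; lra.
Qed.

End Summability.

(** * One majorize-minimize step *)

Section MM.
Context {R : realType} {N : nat}.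
Implicit Types (x y d : 'cV[R]_N).

Lemma pls_cost_convex (Q : 'M[R]_N) q Psi x d s : psdmx Q ->
    convex_function [set: 'cV[R]_N] Psi -> 0 <= s <= 1 ->
  pls_cost Q q Psi (x + s *: d) <=
    (1 - s) * pls_cost Q q Psi x + s * pls_cost Q q Psi (x + d).
Proof.
move=> [Qs Q0] cPsi s01; have := convex_functionE (x + d) x cPsi s01.
have -> : s *: (x + d) + (1 - s) *: x = x + s *: d.
  by rewrite scalerDr scalerBl scale1r addrC addrA subrK.
rewrite !(pls_cost_expand _ _ Qs) -scalemxAr !dotZr !dotZl.
have /andP[s0 s1] := s01; have dd := Q0 d.
have : 0 <= s * (1 - s) * dot d (Q *m d) by rewrite !mulr_ge0// subr_ge0.
move: (Psi _) (Psi _) (Psi _) (dot _ _) (dot _ _) (pls_cost _ _ _ _) => *; lra.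
Qed.

(** The Polyak-Lojasiewicz type estimate behind the rate. Within distance [delta]
of [x] the Hessian is at least [(1 + eps)^-1 H], because it varies by at most
[eps^2 / (2 (1 + eps))] and [eps / 2 <= H]; Taylor's formula and Fenchel-Young
then give the bound. Further away, the same expansion at distance exactly [delta]
shows that [F] is at least [F x] on that sphere, the gradient being small, and
convexity propagates this along rays. *)
Lemma pls_cost_lower (Q : 'M[R]_N) q Psi x eps delta
    (F := pls_cost Q q Psi) (g := grad F x) (H := hess F x) :
    psdmx Q -> C2 Psi -> convex_function [set: 'cV[R]_N] Psi ->
    0 < eps -> 0 < delta -> pdmx H ->
    (forall v, eps / 2 * dot v v <= dot v (H *m v)) ->
    (forall d, enorm d <= delta -> forall v,
       `|dot v ((hess Psi (x + d) - hess Psi x) *m v)|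
         <= eps ^+ 2 / (2 * (1 + eps)) * dot v v) ->
    enorm g <= eps * delta / (4 * (1 + eps)) ->
  forall y, F x - (1 + eps) / 2 * dot g (invmx H *m g) <= F y.
Proof.
move=> Qpsd C2Psi cPsi eps0 delta0 Hpd Heps Hunif gsmall y.
have [Qs Q0] := Qpsd; have [dPsi ddPsi _] := C2Psi.
have e1 : 0 < 1 + eps by rewrite addr_gt0.
have HE : H = Q + hess Psi x by rewrite /H hess_pls_cost.
have near d : enorm d <= delta ->
    F x + dot g d + 2^-1 * ((1 + eps)^-1 * dot d (H *m d)) <= F (x + d).
  move=> dd.
  have tay := @taylor_form_ge _ _ Psi x d
    (dot d (hess Psi x *m d) - eps ^+ 2 / (2 * (1 + eps)) * dot d d) C2Psi.
  have {}tay : Psi x + dot (grad Psi x) d + 2^-1 *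
     (dot d (hess Psi x *m d) - eps ^+ 2 / (2 * (1 + eps)) * dot d d) <= Psi (x + d).
    apply: tay => t /andP[t0 t1].
    have td : enorm (t *: d) <= delta.
      by rewrite enormZ ger0_norm// (le_trans _ dd)// ler_piMl ?enorm_ge0.
    have := Hunif _ td d.
    move: (hess Psi (x + _)) (hess Psi x) => H1 H2.
    by rewrite mulmxBl dotDr dotNr ler_norml => /andP[+ _]; lra.
  have gE : g = Q *m x - q + grad Psi x by rewrite /g grad_pls_cost.
  rewrite {2}/F pls_cost_expand// -/F gE (dotDl d (_ - _)).
  have := Heps d; rewrite HE mulmxDl dotDr => dH.
  have : eps ^+ 2 / (2 * (1 + eps)) * dot d d <=
     eps / (1 + eps) * (dot d (Q *m d) + dot d (hess Psi x *m d)).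
    have -> : eps ^+ 2 / (2 * (1 + eps)) * dot d d = eps / (1 + eps) * (eps / 2 * dot d d).
      by field; rewrite gt_eqF.
    by rewrite ler_pM2l// divr_gt0.
  have -> : eps / (1 + eps) = 1 - (1 + eps)^-1 by field; rewrite gt_eqF.
  move: tay; move: (eps ^+ 2 / _ * _) ((1 + eps)^-1) (Psi x) (Psi (x + d)) (F x)
    (dot d (Q *m d)) (dot d (hess Psi x *m d)) (dot (Q *m x - q) d) (dot (grad Psi x) d).
  clear=> *; lra.
have [d yE] : exists d, y = x + d by exists (y - x); rewrite addrC subrK.
have gHg : 0 <= dot g (invmx H *m g) by exact: (pdmx_psdmx (pdmx_inv Hpd)).2.
have [dd|dd] := leP (enorm d) delta.
  rewrite yE; apply: le_trans (near d dd).
  have := pdmx_fenchel g (- (1 + eps)^-1 *: d) Hpd.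
  rewrite (mulmxEs H) !dotEs -(ler_pM2l (_ : 0 < (1 + eps) / 2)) ?divr_gt0// => fen.
  rewrite -[leRHS]addrA lerD2l lerNl; apply: le_trans fen.
  by rewrite le_eqVlt; apply/orP; left; apply/eqP; field; rewrite gt_eqF.
have ed0 : 0 < enorm d by exact: lt_trans dd.
pose s := delta / enorm d.
have s0 : 0 < s by rewrite divr_gt0.
have s1 : s <= 1 by rewrite ler_pdivrMr// mul1r ltW.
have esd : enorm (s *: d) = delta by rewrite enormZ gtr0_norm// divfK// gt_eqF.
have := near (s *: d); rewrite esd => /(_ (lexx _)) nsd.
have conv := pls_cost_convex q x d Qpsd cPsi (_ : 0 <= s <= 1).
have {}conv : F (x + s *: d) <= (1 - s) * F x + s * F (x + d).
  by apply: conv; rewrite (ltW s0).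
have nn : 0 <= dot g (s *: d) + 2^-1 * ((1 + eps)^-1 * dot (s *: d) (H *m (s *: d))).
  have := dot_le_enorm g (s *: d); rewrite esd ler_norml => /andP[+ _].
  have := Heps (s *: d); rewrite -enorm_sqr esd => hq gq.
  have gd : enorm g * delta <= eps * delta / (4 * (1 + eps)) * delta by rewrite ler_pM2r.
  have hq' : (1 + eps)^-1 * (eps / 2 * delta ^+ 2) <=
     (1 + eps)^-1 * dot (s *: d) (H *m (s *: d)) by rewrite ler_pM2l// invr_gt0.
  have E : eps * delta / (4 * (1 + eps)) * delta =
      2^-1 * ((1 + eps)^-1 * (eps / 2 * delta ^+ 2)) by field; rewrite gt_eqF.
  move: gd; rewrite E; lra.
have : s * F x <= s * F (x + d) by lra.
rewrite ler_pM2l// -yE => FxFy; apply: le_trans FxFy.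
by rewrite gerBl mulr_ge0// ltW// divr_gt0.
Qed.

(** The new iterate beats every competitor [x + z] of the subspace in the majorant,
and the majorant is tangent to [f] at [x]. *)
Lemma mm_decrease m (f : 'cV[R]_N -> R) (A : 'M[R]_N) (D : 'M[R]_(N, m)) x x1 z :
    argmin (ranmx D) (fun y => majorant f A y x) x1 ->
    (forall y, f y - f x <= majorant f A y x - majorant f A x x) ->
    ranmx D x -> ranmx D z ->
  f x1 <= f x + dot (grad f x) z + 2^-1 * dot z (A *m z).
Proof.
move=> [_ x1min] fmaj [w _ wx] [v _ vz].
have Dxz : ranmx D (x + z) by exists (w + v) => //; rewrite mulmxDr wx vz.
have := x1min _ Dxz; have := fmaj x1.
rewrite /majorant subrr mulmx0 !dot0r mulr0 !addr0 (addrC x z) addrK.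
move: (f x1) (f x) (dot _ z) (dot z _) (dot _ _) (dot _ _) => *; lra.
Qed.

(** The competitor is [x - C g], the minimiser of the majorant on the subspace. *)
Lemma mm_descent m (f : 'cV[R]_N -> R) (A : 'M[R]_N) (D : 'M[R]_(N, m)) x x1
    (g := grad f x) :
    A^T = A -> argmin (ranmx D) (fun y => majorant f A y x) x1 ->
    (forall y, f y - f x <= majorant f A y x - majorant f A x x) -> ranmx D x ->
  f x1 <= f x - 2^-1 * dot g (mm_C A D *m g).
Proof.
move=> As x1min fmaj Dx.
have DC : ranmx D (- (mm_C A D *m g)).
  exists (- (mp_inverse (D^T *m A *m D) *m (D^T *m g))) => //.
  by rewrite mulmxN /mm_C !mulmxA.
apply: le_trans (mm_decrease x1min fmaj Dx DC) _.
rewrite (mulmxEs A) !dotEs opprK mm_C_quad// -/g; lra.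
Qed.

(** The competitor is the gradient step of length [1 / L]. *)
Lemma mm_descent_grad m (f : 'cV[R]_N -> R) (A : 'M[R]_N) (D : 'M[R]_(N, m)) x x1 L
    (g := grad f x) : 0 < L -> (forall v, dot v (A *m v) <= L * dot v v) ->
    argmin (ranmx D) (fun y => majorant f A y x) x1 ->
    (forall y, f y - f x <= majorant f A y x - majorant f A x x) -> ranmx D x ->
    ranmx D g ->
  f x1 <= f x - (2 * L)^-1 * dot g g.
Proof.
move=> L0 AL x1min fmaj Dx [w _ wg].
have Dg : ranmx D (- L^-1 *: g).
  by exists (- L^-1 *: w) => //; rewrite -scalemxAr wg.
apply: le_trans (mm_decrease x1min fmaj Dx Dg) _.
apply: (@le_trans _ _ (f x + dot g (- L^-1 *: g)
   + 2^-1 * (L * dot (- L^-1 *: g) (- L^-1 *: g)))).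
  by rewrite lerD2l ler_pM2l ?invr_gt0.
rewrite !dotEs le_eqVlt; apply/orP; left; apply/eqP; field.
by rewrite gt_eqF.
Qed.

(** Comparing [x1] with the competitor [0] gives
[x1 . A x1 / 2 <= (A x - grad f x) . x1], in which [x] occurs only through the
linear term of the majorant. *)
Lemma mm_step_bounded m (f : 'cV[R]_N -> R) (A : 'M[R]_N) (D : 'M[R]_(N, m)) x x1 eta K :
    A^T = A -> 0 < eta -> (forall v, eta * dot v v <= dot v (A *m v)) ->
    argmin (ranmx D) (fun y => majorant f A y x) x1 ->
    enorm (A *m x - grad f x) <= K ->
  enorm x1 <= 2 * K / eta.
Proof.
move=> As eta0 Aeta [_ x1min] xK.
have D0 : ranmx D 0 by exists 0; rewrite ?mulmx0.
have K0 : 0 <= K by exact: le_trans (enorm_ge0 _) xK.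
have := x1min 0 D0; rewrite /majorant !(mulmxEs A) !dotEs.
rewrite (dot_symmx x1 x As) => H0.
have H1 : 2^-1 * dot x1 (A *m x1) <= dot (A *m x - grad f x) x1.
  by rewrite !dotEs (dotC (A *m x)) (dot_symmx x1 x As); lra.
have H2 := le_trans (ler_norm _) (dot_le_enorm (A *m x - grad f x) x1).
have H3 := Aeta x1; rewrite -enorm_sqr in H3.
have n0 := enorm_ge0 x1.
have H4 : enorm (A *m x - grad f x) * enorm x1 <= K * enorm x1 by rewrite ler_wpM2r.
rewrite ler_pdivlMr//.
have [e0|e0] := ltP 0 (enorm x1); last first.
  by have -> : enorm x1 = 0 by [apply: le_anti; rewrite e0]; rewrite mul0r mulr_ge0.
rewrite -(ler_pM2r e0); lra.
Qed.

End MM.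

(** * Behaviour of the whole sequence *)

Section Sequence.
Context {R : realType} {N : nat}.

(** The level sets are bounded since the cost grows quadratically. *)
Lemma pls_cost_level_bounded (Q : 'M[R]_N) q Psi (lb eps c : R) : 0 < eps ->
    (forall v, eps * dot v v <= dot v (Q *m v)) -> (forall x, lb <= Psi x) ->
  exists M, forall x, pls_cost Q q Psi x <= c -> enorm x <= M.
Proof.
move=> eps0 Qeps Psilb; exists (1 + 2 * (enorm q + `|c - lb|) / eps) => x.
rewrite /pls_cost => xc.
have H1 := Qeps x; rewrite -enorm_sqr in H1.
have H2 := le_trans (ler_norm _) (dot_le_enorm q x).
have H3 := Psilb x; have H4 := ler_norm (c - lb).
have n0 := enorm_ge0 x; have q0 := enorm_ge0 q; have a0 := normr_ge0 (c - lb).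
have H : 2^-1 * (eps * enorm x ^+ 2) <= enorm q * enorm x + `|c - lb| by lra.
rewrite leNgt; apply/negP => big.
have x1 : 1 < enorm x.
  by apply: le_lt_trans big; rewrite lerDl divr_ge0 ?mulr_ge0 ?addr_ge0// ltW.
have {}big : 2 * (enorm q + `|c - lb|) < eps * enorm x.
  rewrite -ltr_pdivrMl// mulrC; apply: lt_trans big.
  by rewrite ltrDr.
have : 2 * (enorm q + `|c - lb|) * enorm x < eps * enorm x * enorm x.
  by rewrite ltr_pM2r// (lt_trans ltr01).
have : `|c - lb| <= `|c - lb| * enorm x by rewrite ler_peMr// ltW.
move: H; move: (enorm x) (enorm q) `|c - lb| => *; lra.
Qed.

Lemma pls_cost_change (Q Q' : 'M[R]_N) q q' Psi x :
  pls_cost Q' q' Psi x <= pls_cost Q q Psi x +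
    (2^-1 * spectral_norm (Q - Q') * enorm x ^+ 2 + enorm (q - q') * enorm x).
Proof.
have := form_le_spectral (Q - Q') x; rewrite ler_norml => /andP[+ _].
have := le_trans (ler_norm _) (dot_le_enorm (q - q') x).
by rewrite /pls_cost mulmxBl !dotEs; lra.
Qed.

(** Along a bounded sequence, replacing [F n] by [F n.+1] costs at most a summable
amount, so that the decrease [c |g n|^2] at each step is summable too. *)
Lemma gradient_cvg0 (Q : nat -> 'M[R]_N) (q x g : nat -> 'cV[R]_N) Psi
    (M C c lb S1 S2 : R) (F := fun n => pls_cost (Q n) (q n) Psi) :
    (0 < N)%N -> 0 < c ->
    (forall n, F n (x n.+1) <= F n (x n) - c * dot (g n) (g n)) ->
    (forall n, enorm (x n) <= M) -> (forall n, enorm (q n) <= C) ->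
    (forall n v, 0 <= dot v (Q n *m v)) -> (forall y, lb <= Psi y) ->
    (forall n, \sum_(0 <= k < n) enorm (q k - q k.+1) <= S1) ->
    (forall n, \sum_(0 <= k < n) spectral_norm (Q k - Q k.+1) <= S2) ->
  forall eta, 0 < eta -> exists n0, forall n, (n0 <= n)%N -> enorm (g n) <= eta.
Proof.
move=> N0 c0 descent xM qC Q0 Psilb sq sQ eta eta0.
have M0 : 0 <= M by exact: le_trans (enorm_ge0 _) (xM 0%N).
have C0 : 0 <= C by exact: le_trans (enorm_ge0 _) (qC 0%N).
pose a n := 2^-1 * spectral_norm (Q n - Q n.+1) * M ^+ 2 + enorm (q n - q n.+1) * M.
have step n : F n.+1 (x n.+1) <= F n (x n) - c * dot (g n) (g n) + a n.
  apply: le_trans (pls_cost_change (Q n) (Q n.+1) (q n) (q n.+1) Psi (x n.+1)) _.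
  apply: lerD; first exact: descent.
  apply: lerD; last by rewrite ler_wpM2l ?enorm_ge0.
  rewrite ler_wpM2l ?mulr_ge0 ?spectral_norm_ge0 ?invr_ge0//.
  by rewrite ler_pXn2r ?nnegrE ?enorm_ge0.
have low n : lb - C * M <= F n (x n).
  have := Q0 n (x n); have := Psilb (x n).
  have := le_trans (ler_norm _) (dot_le_enorm (q n) (x n)).
  have : enorm (q n) * enorm (x n) <= C * M by rewrite ler_pM ?enorm_ge0.
  rewrite /F /pls_cost; lra.
have sa n : \sum_(0 <= k < n) a k <= 2^-1 * S2 * M ^+ 2 + S1 * M.
  rewrite big_split/= -!mulr_suml -mulr_sumr.
  by apply: lerD; rewrite ler_wpM2r ?sqr_ge0// ler_wpM2l// invr_ge0.
have e0 n : 0 <= c * dot (g n) (g n) by rewrite mulr_ge0 ?dot_ge0// ltW.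
have /cvgrPdist_le /(_ (c * eta ^+ 2)) := descent_cvg0 e0 step low sa.
have ce0 : 0 < c * eta ^+ 2 by rewrite mulr_gt0// exprn_gt0.
move=> /(_ ce0)[n0 _ Hn0]; exists n0 => n n0n.
have := Hn0 n n0n; rewrite /= sub0r normrN ger0_norm// ler_pM2l// -enorm_sqr.
by rewrite ler_pXn2r ?nnegrE ?enorm_ge0// ltW.
Qed.

End Sequence.

(** * The convergence rate *)

Theorem proposition2 (R : realType) (N : nat) (hN : (0 < N)%N)
  (* cost functions; sequences are indexed by n >= 1, index 0 is ignored *)
  (r : 'cV[R]_N) (Rm : 'M[R]_N) (Psi : 'cV[R]_N -> R)
  (rn : nat -> 'cV[R]_N) (Rn : nat -> 'M[R]_N)
  (hRm : pdmx Rm)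
  (hPsi_lb : has_lbound (range Psi))
  (hPsi_C2 : C2 Psi)
  (hPsi_cvx : convex_function [set: 'cV[R]_N] Psi)
  (hRn : forall n, (1 <= n)%N -> psdmx (Rn n))
  (Fn := fun n => pls_cost (Rn n) (rn n) Psi)
  (* majorant *)
  (B : 'cV[R]_N -> 'M[R]_N)
  (hB : forall x, psdmx (B x))
  (An := fun n x => Rn n + B x)
  (Theta := fun n x y => majorant (Fn n) (An n y) x y)
  (* MM subspace algorithm *)
  (h : nat -> 'cV[R]_N)
  (M : nat -> nat) (D : forall n, 'M[R]_(N, M n))
  (hmaj : forall n, (1 <= n)%N -> forall x,
     Fn n x - Fn n (h n) <= Theta n x (h n) - Theta n (h n) (h n))
  (hM : forall n, (1 <= n)%N -> (1 <= M n)%N)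
  (hD : forall n, (1 <= n)%N -> ranmx (D n) (- grad (Fn n) (h n)))
  (hMM : forall n, (1 <= n)%N ->
     argmin (ranmx (D n)) (fun x => Theta n x (h n)) (h n.+1))
  (* Assumption 1 *)
  (hA1i_r : cvgn (series (fun k => enorm (rn k.+1 - rn k.+2))))
  (hA1i_R : cvgn (series (fun k => spectral_norm (Rn k.+1 - Rn k.+2))))
  (hA1ii_r : rn @ \oo --> r)
  (hA1ii_R : Rn @ \oo --> Rm)
  (* Assumption 2 *)
  (hA2i : forall n, (1 <= n)%N ->
     ranmx (D n) (grad (Fn n) (h n)) /\ ranmx (D n) (h n))
  (hA2ii : exists V : 'M[R]_N, pdmx V /\ forall n, (1 <= n)%N ->
     loewner_le (hess Psi (h n)) (B (h n)) /\ loewner_le (B (h n)) V)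
  (hA2iii :
     (forall n, (1 <= n)%N -> rn n = r /\ Rn n = Rm)
     \/ (exists K : R, forall x, enorm (B x *m x - grad Psi x) <= K))
  (eps : R) (heps : 0 < eps) (hepsR : loewner_lt eps%:M Rm) :
  exists n_eps : nat, (1 <= n_eps)%N /\ forall n, (n_eps <= n)%N ->
    let H := hess (Fn n) (h n) in
    let A := An n (h n) in
    let infF := inf (range (Fn n)) in
    let theta := 1 - (1 + eps)^-1 * theta_tilde (Fn n) A (D n) (h n) in
    let K := sqrtmx A *m invmx H *m sqrtmx A in
    let kappa_lo := min_eigenvalue K in
    let kappa_up := max_eigenvalue K in
    let sigma_lo := min_eigenvalue H in
    let sigma_up := max_eigenvalue H in
    let theta_lo := 1 - (1 + eps)^-1 * kappa_lo^-1 in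
    let theta_up := 1 - (1 + eps)^-1 * kappa_up^-1 *
      (1 - ((sigma_up - sigma_lo) / (sigma_up + sigma_lo)) ^+ 2) in
    [/\ loewner_le (Rm - eps%:M) H,
        Fn n (h n.+1) - infF <= theta * (Fn n (h n) - infF),
        (* for a zero gradient the quotient theta_tilde is undefined *)
        grad (Fn n) (h n) != 0 -> theta_lo <= theta <= theta_up,
        1 <= kappa_lo
      & 0 < theta_lo /\ theta_up < 1].

Proof.
have [V [Vpd HV]] := hA2ii.
have [dPsi ddPsi cH] := hPsi_C2.
have [lb Hlb] : exists lb, forall x, lb <= Psi x.
  by have [lb Hlb] := hPsi_lb; exists lb => x; apply: Hlb; exists x.
have Rm_eps v : eps * dot v v <= dot v (Rm *m v).
  have := (pdmx_psdmx hepsR).2 v.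
  by rewrite mulmxBl mul_scalar_mx !dotEs subr_ge0.
have eps20 : 0 < eps / 2 by rewrite divr_gt0.
have e1 : 0 < 1 + eps by rewrite addr_gt0.
have [n1 _ HRn] := cvg_form hA1ii_R eps20.
have [n2 _ Hrn] := cvg_enorm_bounded hA1ii_r.
pose m := (n1 + n2).+1.
have mn1 n : (m <= n)%N -> (n1 <= n)%N by rewrite /m; lia.
have mn2 n : (m <= n)%N -> (n2 <= n)%N by rewrite /m; lia.
have m1 n : (m <= n)%N -> (1 <= n)%N by rewrite /m; lia.
have Rn_form n v : (m <= n)%N -> `|dot v (Rn n *m v) - dot v (Rm *m v)| <= eps / 2 * dot v v.
  by move=> /mn1 /HRn /(_ v); rewrite mulmxBl dotDr dotNr.
have Rn_lower n v : (m <= n)%N -> eps / 2 * dot v v <= dot v (Rn n *m v).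
  move=> /(Rn_form _ v); rewrite ler_norml => /andP[+ _].
  by have := Rm_eps v; lra.
have An_sym n : (1 <= n)%N -> (An n (h n))^T = An n (h n).
  by move=> n_gt0; rewrite linearD/= (hRn n n_gt0).1 (hB _).1.
have An_lower n v : (m <= n)%N -> eps / 2 * dot v v <= dot v (An n (h n) *m v).
  move=> mn; rewrite mulmxDl dotDr; apply: le_trans (Rn_lower _ v mn) _.
  by rewrite lerDl (hB _).2.
pose L := N%:R * `|Rm| + eps / 2 + N%:R * `|V|.
have L0 : 0 < L by rewrite ltr_wpDr ?mulr_ge0// ltr_wpDl ?mulr_ge0.
have An_upper n v : (m <= n)%N -> dot v (An n (h n) *m v) <= L * dot v v.
  move=> mn; rewrite mulmxDl dotDr !mulrDl.
  apply: lerD.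
    have := Rn_form _ v mn; rewrite ler_norml => /andP[_].
    by have := le_trans (ler_norm _) (form_le_norm Rm v); lra.
  have := (HV n (m1 n mn)).2.2 v; rewrite mulmxBl !dotEs subr_ge0.
  by move/le_trans; apply; exact: le_trans (ler_norm _) (form_le_norm V v).
have step_le n : (1 <= n)%N -> Fn n (h n.+1) <= Fn n (h n).
  move=> n_gt0; have D0 : ranmx (D n) 0 by exists 0; rewrite ?mulmx0.
  have := mm_decrease (hMM n n_gt0) (hmaj n n_gt0) (hA2i n n_gt0).2 D0.
  by rewrite mulmx0 !dotEs mulr0 !addr0.
have gradE n x : (1 <= n)%N -> grad (Fn n) x = Rn n *m x - rn n + grad Psi x.
  by move=> n_gt0; rewrite grad_pls_cost//; exact: (hRn n n_gt0).1.
(* With exact data the cost itself decreases, and its level sets are bounded. In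
   the other case each step lands in a fixed ball, since
   [A h - grad = (B h - grad Psi) + r] is bounded. *)
have [Mb [m' HM]] : exists Mb m', forall n, (m' <= n)%N -> enorm (h n) <= Mb.
  case: hA2iii => [Ha|[K HK]].
    have [Mb HM] := pls_cost_level_bounded r (Fn 1%N (h 1%N)) heps Rm_eps Hlb.
    exists Mb, 1%N => n n_gt0; apply: HM.
    elim: n n_gt0 => // -[_ _|n IH _].
      by have [r1 R1] := Ha 1%N isT; rewrite /Fn r1 R1.
    have := step_le n.+1 isT; rewrite {1 2}/Fn; have [-> ->] := Ha n.+1 isT.
    by move/le_trans; apply; exact: IH.
  exists (2 * (K + (enorm r + N%:R)) / (eps / 2)), m.+1 => -[//|n] mn.
  have n_gt0 := m1 n mn.
  apply: (mm_step_bounded (An_sym n n_gt0) eps20 _ (hMM n n_gt0)).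
    by move=> v; exact: An_lower.
  have -> : An n (h n) *m h n - grad (Fn n) (h n) = (B (h n) *m h n - grad Psi (h n)) + rn n.
    rewrite gradE// mulmxDl; move: (Rn n *m h n) (B (h n) *m h n) (grad Psi (h n)) => a b c.
    by apply/matrixP => i j; rewrite !mxE; ring.
  apply: le_trans (enormD _ _) _; apply: lerD => //.
  exact: Hrn (mn2 n mn).
(* Shifting the sequences by [p], all eventual properties hold from the start;
   index [0] is skipped, hence the successors. *)
pose p := (m + m')%N.
have pm k : (m <= (k + p).+1)%N by rewrite /p; lia.
have pm' k : (m' <= (k + p).+1)%N by rewrite /p; lia.
have [S1 HS1] := series_shift_bounded (fun k => enorm_ge0 (rn k.+1 - rn k.+2)) hA1i_r.
have [S2 HS2] := series_shift_bounded (fun k => spectral_norm_ge0 (Rn k.+1 - Rn k.+2) hN) hA1i_R.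
have c0 : 0 < (2 * L)^-1 by rewrite invr_gt0 mulr_gt0.
have descent k : Fn (k + p).+1 (h (k + p).+2) <= Fn (k + p).+1 (h (k + p).+1) -
   (2 * L)^-1 * dot (grad (Fn (k + p).+1) (h (k + p).+1)) (grad (Fn (k + p).+1) (h (k + p).+1)).
  have k1 := m1 _ (pm k); have [Dg Dh] := hA2i _ k1.
  apply: mm_descent_grad (hMM _ k1) (hmaj _ k1) Dh Dg => //.
  by move=> v; exact: An_upper.
have gcvg := @gradient_cvg0 R N (fun k => Rn (k + p).+1) (fun k => rn (k + p).+1)
  (fun k => h (k + p).+1) (fun k => grad (Fn (k + p).+1) (h (k + p).+1)) Psi Mb
  (enorm r + N%:R) _ lb S1 S2 hN c0 descent (fun k => HM _ (pm' k)) (fun k => Hrn _ (mn2 _ (pm k)))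
  (fun k => (hRn _ (m1 _ (pm k))).2) Hlb (HS1 p) (HS2 p).
(* The variation of the Hessian and the size of the gradient that
   [pls_cost_lower] tolerates. *)
have rho0 : 0 < eps ^+ 2 / (2 * (1 + eps)).
  by rewrite divr_gt0 ?exprn_gt0// mulr_gt0.
have [delta delta0 Hdelta] := hess_unif_continuous Mb cH rho0.
have eta0 : 0 < eps * delta / (4 * (1 + eps)) by rewrite divr_gt0 ?mulr_gt0.
have [n3 Hn3] := gcvg _ eta0.
exists (n3 + p).+1; split=> // n nn.
have [k -> kn3] : exists2 k, n = (k + p).+1 & (n3 <= k)%N.
  by exists (n - p.+1)%N; lia.
have {}Hn3 := Hn3 k kn3; have mn := pm k; have m'n := pm' k.
move: (k + p).+1 mn m'n Hn3 => {nn k kn3} n mn m'n Hn3; have n_gt0 := m1 n mn.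
move=> H A infF theta K kappa_lo kappa_up sigma_lo sigma_up theta_lo theta_up.
have [hessle BleV] := HV n n_gt0.
have HE : H = Rn n + hess Psi (h n) by rewrite /H hess_pls_cost//; exact: (hRn n n_gt0).1.
(* Symmetry of second derivatives at [h n], from that of [B (h n)]. *)
have Psi_sym : (hess Psi (h n))^T = hess Psi (h n).
  have := hessle.1; rewrite linearB/= (hB _).1 => /addrI /oppr_inj.
  by [].
have Hs : H^T = H by rewrite HE linearD/= (hRn n n_gt0).1 Psi_sym.
have Hform v : eps / 2 * dot v v <= dot v (H *m v).
  rewrite HE mulmxDl dotDr; apply: le_trans (Rn_lower _ v mn) _.
  by rewrite lerDl convex_hess_ge0.
have pd_of (P : 'M[R]_N) : P^T = P -> (forall v, eps / 2 * dot v v <= dot v (P *m v)) -> pdmx P.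
  by move=> Ps HP; split=> // v v0; apply: lt_le_trans (HP v); rewrite mulr_gt0// dot_gt0.
have Hpd := pd_of H Hs Hform.
have Apd : pdmx A by apply: pd_of; [exact: An_sym|move=> v; exact: An_lower].
have HA : loewner_le H A.
  have -> : loewner_le H A = loewner_le (hess Psi (h n)) (B (h n)); last by [].
  rewrite /loewner_le HE /A /An; congr psdmx.
  by rewrite opprD addrACA subrr add0r.
have [Dg Dh] := hA2i n n_gt0.
have [k1 kup sl su tb] := theta_bounds hN Hpd Apd HA Dg.
rewrite -/K -/kappa_lo -/kappa_up -/sigma_lo -/sigma_up in k1 kup sl su tb.
have kl0 : 0 < kappa_lo := lt_le_trans ltr01 k1.
split.
- rewrite /loewner_le HE; split.
    have Es : (Rm - eps%:M)^T = Rm - eps%:M by rewrite linearB/= hRm.1 tr_scalar_mx.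
    by rewrite linearB linearD/= (hRn n n_gt0).1 Psi_sym Es.
  move=> v; have := Rn_form n v mn; rewrite ler_norml => /andP[+ _].
  have := convex_hess_ge0 (h n) v hPsi_C2 hPsi_cvx; have := dot_ge0 v.
  rewrite mulmxBl mulmxDl mulmxBl mul_scalar_mx !dotEs.
  have : eps / 2 * dot v v <= eps * dot v v.
    by rewrite ler_wpM2r ?dot_ge0// ler_pdivrMr// ler_peMr ?ler1n// ltW.
  lra.
- have desc := mm_descent (An_sym n n_gt0) (hMM n n_gt0) (hmaj n n_gt0) Dh.
  have [g0|g0] := eqVneq (grad (Fn n) (h n)) 0.
    by rewrite /theta /theta_tilde g0 !dot0l !mul0r mulr0 subr0 mul1r lerD2r step_le.
  have low := pls_cost_lower (hRn n n_gt0) hPsi_C2 hPsi_cvx heps delta0 Hpd Hform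
    (fun d dd => Hdelta (h n) d (HM n m'n) dd) Hn3.
  set g := grad (Fn n) (h n) in g0 desc low Hn3.
  have b0 : 0 < dot g (invmx H *m g) by exact: (pdmx_inv Hpd).2.
  have infle : Fn n (h n) - (1 + eps) / 2 * dot g (invmx H *m g) <= infF.
    apply: lb_le_inf; first by exists (Fn n (h n)); exists (h n).
    by move=> _ [y _ <-]; exact: low.
  have gC : 0 <= dot g (mm_C A (D n) *m g).
    by rewrite -mm_C_quad ?An_sym//; exact: (pdmx_psdmx Apd).2.
  rewrite /theta /theta_tilde -/g -/H -/A.
  move: (dot g (mm_C _ _ *m g)) (dot g (invmx _ *m g)) (Fn n (h n)) (Fn n (h n.+1)) infF
    desc b0 infle gC; clear -eps e1.
  move=> c b f f1 i desc b0 infle c0.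
  have fi : f - i <= (1 + eps) / 2 * b by lra.
  have : (1 + eps)^-1 * (c / b) * (f - i) <= 2^-1 * c.
    apply: le_trans (_ : (1 + eps)^-1 * (c / b) * ((1 + eps) / 2 * b) <= _).
      by rewrite ler_wpM2l// mulr_ge0// ?invr_ge0 ?divr_ge0// ltW.
    by rewrite le_eqVlt; apply/orP; left; apply/eqP; field; rewrite !gt_eqF.
  lra.
- move=> g0; have /andP[tb1 tb2] := tb g0.
  have ie : 0 < (1 + eps)^-1 by rewrite invr_gt0.
  rewrite /theta_lo /theta_up /theta /theta_tilde -/A -/H -mulrA.
  by rewrite !lerD2l !lerN2 !(ler_pM2l ie) tb1 tb2.
- exact: k1.
- split.
    rewrite /theta_lo subr_gt0 -invfM invf_lt1 ?mulr_gt0//.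
    apply: lt_le_trans (_ : 1 + eps <= _); first by rewrite ltrDl.
    by rewrite ler_peMr// ltW.
  rewrite /theta_up ltrBlDr ltrDl !mulr_gt0 ?invr_gt0//.
  have -> : 1 - ((sigma_up - sigma_lo) / (sigma_up + sigma_lo)) ^+ 2 =
      4 * (sigma_lo * sigma_up) / (sigma_lo + sigma_up) ^+ 2.
    by field; rewrite gt_eqF ?addr_gt0.
  by rewrite divr_gt0 ?exprn_gt0 ?addr_gt0 ?mulr_gt0.
Qed.
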